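(* Let $\alpha\in(0,1)$ be any irrational number and let $1<p<\infty$. Then the local spectral subspace $X_{T_\alpha}\big(\partial D(0,e^{-1})\big)$ (respectively, $X_{T_\alpha^*}\big(\partial D(0,e^{-1})\big)$) is dense in $L^p[0,1)$. In particular, neither $T_\alpha$ nor $T_\alpha^*$ has the Dunford property $(C)$ on $L^p[0,1)$.
   Context: $\{\cdot\}$ denotes the fractional part. The Bishop operator on complex $L^p[0,1)$ is $T_\alpha f(t)=t\,f(\{t+\alpha\})$; its adjoint is given by $T_\alpha^*g(t)=\{t-\alpha\}\,g(\{t-\alpha\})$, regarded here as an operator on $L^p[0,1)$ (the adjoint of $T_\alpha$ acting on $L^{p'}[0,1)$, $1/p+1/p'=1$). $\partial D(0,e^{-1})=\{\lambda\in\mathbb{C}:|\lambda|=e^{-1}\}$. For a complex Banach space $\mathcal{X}$, a bounded linear operator $T$ on $\mathcal{X}$ and $x\in\mathcal{X}$, the local resolvent $\rho_T(x)$ is the set of $\lambda\in\mathbb{C}$ for which there exist an open neighborhood $U_\lambda$ of $\lambda$ and an analytic function $f:U_\lambda\to\mathcal{X}$ with $(T-zI)f(z)=x$ for all $z\in U_\lambda$; the local spectrum is $\sigma_T(x)=\mathbb{C}\setminus\rho_T(x)$. For $F\subseteq\mathbb{C}$ the local spectral subspace is $X_T(F)=\{x\in\mathcal{X}:\sigma_T(x)\subseteq F\}$ (a linear manifold, not necessarily closed). $T$ has the Dunford property $(C)$ if $X_T(F)$ is closed for every closed $F\subseteq\mathbb{C}$. *)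

(* Defs.v *)
From HB Require Import structures.
From mathcomp Require Import all_boot all_order all_algebra.
From mathcomp Require Import all_classical all_reals all_analysis measurable_realfun.
From mathcomp Require Import complex ring lra.

Set Implicit Arguments.
Unset Strict Implicit.
Unset Printing Implicit Defensive.
Import Order.TTheory GRing.Theory Num.Theory.
Import numFieldNormedType.Exports.
Import Normc.

Local Open Scope classical_set_scope.
Local Open Scope ring_scope.
Local Open Scope complex_scope.
Local Open Scope quotient_scope.

(* C = R[i] with the norm topology that the library puts on the regular module
   R[i]^o. *)
HB.instance Definition _ (R : rcfType) := GRing.ComAlgebra.copy R[i] R[i]^o.
HB.instance Definition _ (R : rcfType) := Vector.copy R[i] R[i]^o.
HB.instance Definition _ (R : rcfType) := NormedModule.copy R[i] R[i]^o.

Section complex_Lp.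
Context d (T : measurableType d) (R : realType).
Variable mu : {measure set T -> \bar R}.

(* The library has no sigma-algebra on R[i]; measurability for the Borel sets of
   C is measurability of the real and imaginary parts. *)
Definition cmeasurable (f : T -> R[i]) :=
  measurable_fun [set: T] (fun t => complex.Re (f t)) /\
  measurable_fun [set: T] (fun t => complex.Im (f t)).

Lemma cmeasurable0 : cmeasurable (fun=> 0).
Proof. by split; exact: measurable_cst. Qed.

Lemma cmeasurableD f g :
  cmeasurable f -> cmeasurable g -> cmeasurable (fun t => f t + g t).
Proof.
move=> [fr fi] [gr gi]; split.
- rewrite (_ : (fun _ => _) = (fun t => complex.Re (f t) + complex.Re (g t))).
    exact: measurable_funD.
  by apply/funext => t; case: (f t); case: (g t).
- rewrite (_ : (fun _ => _) = (fun t => complex.Im (f t) + complex.Im (g t))).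
    exact: measurable_funD.
  by apply/funext => t; case: (f t); case: (g t).
Qed.

Lemma cmeasurableM f g :
  cmeasurable f -> cmeasurable g -> cmeasurable (fun t => f t * g t).
Proof.
move=> [fr fi] [gr gi]; split.
- rewrite (_ : (fun _ => _) = (fun t => complex.Re (f t) * complex.Re (g t)
    - complex.Im (f t) * complex.Im (g t))).
    by apply: measurable_funB; exact: measurable_funM.
  by apply/funext => t; case: (f t); case: (g t).
- rewrite (_ : (fun _ => _) = (fun t => complex.Re (f t) * complex.Im (g t)
    + complex.Im (f t) * complex.Re (g t))).
    by apply: measurable_funD; exact: measurable_funM.
  by apply/funext => t; case: (f t); case: (g t).
Qed.

Lemma cmeasurable_real (w : T -> R) :
  measurable_fun [set: T] w -> cmeasurable (fun t => (w t)%:C).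
Proof. by move=> mw; split => //; exact: measurable_cst. Qed.

Lemma measurable_normc f :
  cmeasurable f -> measurable_fun [set: T] (fun t => normc (f t)).
Proof.
move=> [fr fi].
rewrite (_ : (fun _ => _) =
    Num.sqrt \o (fun t => complex.Re (f t) ^+ 2 + complex.Im (f t) ^+ 2)).
  apply: measurableT_comp.
    exact: continuous_measurable_fun (@sqrt_continuous R).
  by apply: measurable_funD; exact: measurable_funX.
by apply/funext => t /=; case: (f t).
Qed.

Lemma normc_ge0 (z : R[i]) : 0 <= normc z.
Proof. by case: z => a b; exact: sqrtr_ge0. Qed.

Lemma normcD (x y : R[i]) : normc (x + y) <= normc x + normc y.
Proof. exact: le_normcD. Qed.

Lemma normrc (z : R[i]) : `|z| = (normc z)%:C.
Proof. by rewrite normc_def; case: z. Qed.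

Section finite_exponent.
Variables (p : R) (p1 : 1 <= p).

Let p_gt0 : 0 < p. Proof. exact: lt_le_trans p1. Qed.

Definition cLnorm (f : T -> R[i]) : \bar R :=
  'N[mu]_p%:E[EFin \o (fun t => normc (f t))].

Lemma cLnormE f : cLnorm f = ((\int[mu]_t (normc (f t) `^ p)%:E) `^ p^-1)%E.
Proof.
rewrite /cLnorm unlock; apply: (congr1 (fun x => (x `^ p^-1)%E)).
by apply: eq_integral => t _; rewrite /= ger0_norm// normc_ge0.
Qed.

Lemma measurable_normc_powR f : cmeasurable f ->
  measurable_fun [set: T] (fun t => (normc (f t) `^ p)%:E).
Proof.
move=> mf; apply/measurable_EFinP.
by apply: (@measurableT_comp _ _ _ _ _ _ (@powR R ^~ p)) => //;
  exact: measurable_normc.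
Qed.

Lemma le_cLnorm f g : cmeasurable f -> cmeasurable g ->
  (\forall t \ae mu, normc (f t) <= normc (g t)) ->
  (cLnorm f <= cLnorm g)%E.
Proof.
move=> mf mg fg; rewrite !cLnormE; apply: gt0_ler_poweR.
- by rewrite invr_ge0 ltW.
- by rewrite in_itv/= leey integral_ge0// => t _; rewrite lee_fin powR_ge0.
- by rewrite in_itv/= leey integral_ge0// => t _; rewrite lee_fin powR_ge0.
apply: ae_ge0_le_integral => //.
- by move=> t _; rewrite lee_fin powR_ge0.
- exact: measurable_normc_powR.
- by move=> t _; rewrite lee_fin powR_ge0.
- exact: measurable_normc_powR.
apply: filterS fg => t fgt _.
by rewrite lee_fin ge0_ler_powR ?nnegrE ?normc_ge0// ltW.
Qed.

Lemma cLnormD f g : cmeasurable f -> cmeasurable g ->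
  (cLnorm (fun t => f t + g t)%R <= cLnorm f + cLnorm g)%E.
Proof.
move=> mf mg.
have h := @minkowski_EFin _ _ _ mu _ _ p
  (measurable_normc mf) (measurable_normc mg) p1.
apply: (le_trans _ h).
pose s t := (normc (f t) + normc (g t))%:C.
have ms : cmeasurable s.
  by apply: cmeasurable_real; apply: measurable_funD; exact: measurable_normc.
have sE t : normc (s t) = normc (f t) + normc (g t).
  by rewrite /s/= expr0n addr0 sqrtr_sqr ger0_norm// addr_ge0 ?normc_ge0.
rewrite (_ : 'N[mu]_p%:E[_]%E = cLnorm s); last first.
  by apply: eq_Lnorm => t; exact/esym/(congr1 EFin (sE t)).
apply: le_cLnorm => //; first exact: cmeasurableD.
by apply: nearW => t; rewrite sE; exact: normcD.
Qed.

Lemma cLnormZ a f : cmeasurable f ->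
  cLnorm (fun t => a * f t) = ((normc a)%:E * cLnorm f)%E.
Proof.
move=> mf; rewrite !cLnormE.
under eq_integral do rewrite normcM powRM ?normc_ge0// EFinM.
rewrite ge0_integralZl ?lee_fin ?powR_ge0//; last 2 first.
- exact: measurable_normc_powR.
- by move=> t _; rewrite lee_fin powR_ge0.
rewrite poweRM ?lee_fin ?powR_ge0//; last first.
  by apply: integral_ge0 => t _; rewrite lee_fin powR_ge0.
by rewrite poweR_EFin -powRrM mulfV ?gt_eqF// powRr1// normc_ge0.
Qed.

Lemma cLnorm0 : cLnorm (fun=> 0) = 0%E.
Proof.
rewrite /cLnorm (eq_Lnorm _ _ (g := cst 0%E)); last first.
  by move=> t; rewrite normc0.
by rewrite Lnorm0// eqe gt_eqF.
Qed.

Lemma cLnorm_ge0 f : (0 <= cLnorm f)%E.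
Proof. exact: Lnorm_ge0. Qed.

Lemma cLnorm_eq0 f : cmeasurable f ->
  cLnorm f = 0%E -> \forall t \ae mu, f t = 0.
Proof.
move=> mf /Lnorm_eq0_eq0 -/(_ _ _).
have /measurable_EFinP mnf := measurable_normc mf.
move=> /(_ mnf); rewrite lte_fin => /(_ p_gt0).
by apply: filterS => t /(_ I) [] /eq0_normc.
Qed.

(* The argument 1 <= p is not used in the definition; it lets the closure
   properties below be inferred. *)
Definition cLfun (_ : 1 <= p) : {pred T -> R[i]} :=
  mem [set f | cmeasurable f /\ (cLnorm f < +oo)%E].

Lemma cLfun_submod_closed : submod_closed (cLfun p1).
Proof.
split.
  by apply: mem_set; split; [exact: cmeasurable0|rewrite cLnorm0 ltry].
move=> a f g /set_mem[mf lf] /set_mem[mg lg]; apply: mem_set.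
have maf : cmeasurable (fun t => a * f t).
  by apply: cmeasurableM => //; split; exact: measurable_cst.
split; first exact: cmeasurableD.
apply: le_lt_trans (cLnormD maf mg) _.
by rewrite lte_add_pinfty// cLnormZ// lte_mul_pinfty// lee_fin normc_ge0.
Qed.

HB.instance Definition _ :=
  GRing.isSubmodClosed.Build _ _ (cLfun p1) cLfun_submod_closed.

Record cLfunType := CLfun {
  cLfun_fun :> T -> R[i] ;
  cLfunP : cLfun_fun \in cLfun p1 }.

HB.instance Definition _ := [isSub for cLfun_fun].
HB.instance Definition _ := [Choice of cLfunType by <:].
HB.instance Definition _ := [SubChoice_isSubLmodule of cLfunType by <:].

Lemma cLfunBE (f g : cLfunType) t : (f - g) t = f t - g t.
Proof. by []. Qed.

Lemma cLfunDE (f g : cLfunType) t : (f + g) t = f t + g t.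
Proof. by []. Qed.

Lemma cLfunZE a (f : cLfunType) t : (a *: f) t = a * f t.
Proof. by []. Qed.

Definition ae_null : {pred cLfunType} :=
  mem [set f : cLfunType | \forall t \ae mu, f t = 0].

Lemma ae_null_zmod_closed : zmod_closed ae_null.
Proof.
split; first by apply: mem_set; exact: nearW.
move=> f g /set_mem/= f0 /set_mem/= g0; apply: mem_set => /=.
by apply: filterS2 f0 g0 => t ft gt; rewrite -[LHS]/(f t - g t) ft gt subrr.
Qed.

HB.instance Definition _ :=
  GRing.isZmodClosed.Build _ ae_null ae_null_zmod_closed.

(* L^p(mu; C): p-integrable functions modulo equality mu-almost everywhere. *)
Definition cLspace : Type := Quotient.quot ae_null.

HB.instance Definition _ := GRing.Zmodule.on cLspace.
HB.instance Definition _ := EqQuotient.on cLspace.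

Lemma cLspace_eqP (f g : cLfunType) :
  \pi_cLspace f = \pi_cLspace g <-> \forall t \ae mu, f t = g t.
Proof.
have -> : (\pi_cLspace f = \pi_cLspace g) <-> (f - g \in ae_null).
  rewrite Quotient.idealrBE; split; first by move=> ->.
  by move/eqP.
split=> [/set_mem/=|fg].
  by apply: filterS => t /eqP; rewrite -[X in X == _]/(f t - g t) subr_eq0 => /eqP.
apply: mem_set; apply: filterS fg => t fgt.
by rewrite -[LHS]/(f t - g t) fgt subrr.
Qed.

Lemma repr_cLspace (f : cLfunType) :
  \forall t \ae mu, repr (\pi_cLspace f) t = f t.
Proof. by apply/cLspace_eqP; rewrite reprK. Qed.

Lemma pi_cLspaceD (f g : cLfunType) :
  \pi_cLspace (f + g) = \pi_cLspace f + \pi_cLspace g.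
Proof. exact: raddfD. Qed.

Definition cLscale (a : R[i]) (F : cLspace) : cLspace :=
  \pi_cLspace (a *: repr F).

Lemma pi_cLspaceZ a (f : cLfunType) :
  \pi_cLspace (a *: f) = cLscale a (\pi_cLspace f).
Proof.
apply/cLspace_eqP; apply: filterS (repr_cLspace f) => t ft.
by rewrite !cLfunZE ft.
Qed.

Lemma cLscaleA a b F : cLscale a (cLscale b F) = cLscale (a * b) F.
Proof. 
elim/quotW: F => f.
by rewrite -(pi_cLspaceZ b f) -(pi_cLspaceZ a (b *: f)) -pi_cLspaceZ scalerA.
 Qed.

Lemma cLscale1 : left_id 1 cLscale.
Proof. by elim/quotW => f; rewrite -(pi_cLspaceZ 1 f) scale1r. Qed.

Lemma cLscaleDr : right_distributive cLscale +%R.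
Proof.
move=> a; elim/quotW => f; elim/quotW => g.
rewrite -(pi_cLspaceD f g) -(pi_cLspaceZ a (f + g)) scalerDr pi_cLspaceD.
by rewrite -(pi_cLspaceZ a f) -(pi_cLspaceZ a g).
Qed.

Lemma cLscaleDl F : {morph cLscale^~ F : a b / a + b}.
Proof.
move=> a b; elim/quotW: F => f.
rewrite -(pi_cLspaceZ (a + b) f) scalerDl pi_cLspaceD.
by rewrite -(pi_cLspaceZ a f) -(pi_cLspaceZ b f).
Qed.

HB.instance Definition _ := GRing.Zmodule_isLmodule.Build R[i] cLspace
  cLscaleA cLscale1 cLscaleDr cLscaleDl.

(* The norm of a normedModType R[i] is R[i]-valued, hence the embedding %:C. *)
Definition cLspace_norm (F : cLspace) : R[i] := (fine (cLnorm (repr F)))%:C.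

Lemma cLnorm_fin (f : cLfunType) : cLnorm f \is a fin_num.
Proof.
by rewrite ge0_fin_numE ?cLnorm_ge0//; have /set_mem[] := cLfunP f.
Qed.

Let cLfun_meas (f : cLfunType) : cmeasurable f.
Proof. by have /set_mem[] := cLfunP f. Qed.

Lemma cLspace_norm_pi (f : cLfunType) :
  cLspace_norm (\pi_cLspace f) = (fine (cLnorm f))%:C.
Proof.
rewrite /cLspace_norm; congr (fine _)%:C; apply/eqP; rewrite eq_le.
by apply/andP; split; apply: le_cLnorm => //;
  apply: filterS (repr_cLspace f) => t ->.
Qed.

Lemma ler_cLspace_normD F G :
  cLspace_norm (F + G) <= cLspace_norm F + cLspace_norm G.
Proof.
elim/quotW: F => f; elim/quotW: G => g.
rewrite -(pi_cLspaceD f g) !cLspace_norm_pi -rmorphD lecR.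
rewrite -fineD ?cLnorm_fin// fine_le ?fin_numD ?cLnorm_fin//.
exact: cLnormD.
Qed.

Lemma cLspace_normZ a F : cLspace_norm (a *: F) = `|a| * cLspace_norm F.
Proof.
elim/quotW: F => f; rewrite -[_ *: _]/(cLscale _ _).
rewrite -(pi_cLspaceZ a f) !cLspace_norm_pi.
by rewrite normrc -rmorphM cLnormZ// fineM ?cLnorm_fin.
Qed.

Lemma cLspace_norm_eq0 F : cLspace_norm F = 0 -> F = 0.
Proof.
elim/quotW: F => f; rewrite cLspace_norm_pi => -[/eqP]; rewrite fine_eq0 ?cLnorm_fin// => /eqP F0.
rewrite -(raddf0 \pi_cLspace); apply/cLspace_eqP.
exact: cLnorm_eq0.
Qed.

HB.instance Definition _ := Lmodule_isNormed.Build R[i] cLspace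
  ler_cLspace_normD cLspace_normZ cLspace_norm_eq0.

End finite_exponent.
End complex_Lp.

Section rotation.
Context {R : realType}.

Definition frac (x : R) : R := x - (Num.floor x)%:~R.

Lemma frac_ge0 x : 0 <= frac x. Proof. by rewrite subr_ge0 floor_le. Qed.

Lemma frac_lt1 x : frac x < 1.
Proof. by rewrite ltrBlDl -[X in _ + X]/(1%:~R) -intrD floorD1_gt. Qed.

Lemma frac_def x (m : int) : m%:~R <= x < (m + 1)%:~R -> frac x = x - m%:~R.
Proof. by move=> h; rewrite /frac (floor_def h). Qed.

Lemma fracDz x (m : int) : frac (x + m%:~R) = frac x.
Proof.
by rewrite /frac floorDrz ?intr_int// intrKfloor intrD opprD addrACA subrr addr0.
Qed.

Lemma measurable_frac : measurable_fun [set: R] frac.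
Proof.
apply: measurable_funB; first exact: measurable_id.
apply: nondecreasing_measurable => // x y xy.
by rewrite ler_int floor_ge_int (le_trans (floor_le x)).
Qed.

(* Lebesgue measure on [0,1), as a measure on R vanishing outside [0,1): values
   of functions outside [0,1) are irrelevant modulo equality leb01-a.e. *)
Definition leb01 : {measure set (measurableTypeR R) -> \bar R} :=
  [the measure _ _ of mrestr lebesgue_measure (measurable_itv `[0, 1[)].

Let measurable_shift (c : R) : measurable_fun [set: R] (fun x : R => x + c).
Proof. exact: measurable_funD. Qed.

Lemma lebesgue_measure_shift (c : R) (A : set R) : measurable A ->
  lebesgue_measure ((fun x => x + c) @^-1` A) = lebesgue_measure A.
Proof.
move=> mA; apply/esym.
pose sh : measurableTypeR R -> measurableTypeR R := fun x => x + c.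
have msh : measurable_fun setT sh by exact: measurable_shift.
pose m : {measure set (measurableTypeR R) -> \bar R} :=
  measure_function_pushforward__canonical__measure_function_Measure
  lebesgue_measure msh.
apply: (@lebesgue_measure_unique _ m) => // _ [[a b] _ <-] /=.
rewrite /pushforward (_ : _ @^-1` _ = [set` `]a - c, b - c]]); last first.
  by apply/seteqP; split=> x/=; rewrite !in_itv/= ltrBlDr lerBrDr.
rewrite !lebesgue_measure_itv/= !lte_fin ltrD2r.
by case: ifP => // _; rewrite -!EFinB; congr EFin; ring.
Qed.

Lemma leb01_ae (P : set (measurableTypeR R)) : (forall t, 0 <= t < 1 -> P t) ->
  \forall t \ae leb01, P t.
Proof.
move=> P01; exists (~` `[0, 1[%classic); split.
- exact: measurableC.
- by rewrite -[LHS]/(lebesgue_measure _) setICl measure0.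
- by move=> t /= nP; rewrite in_itv/= => /P01.
Qed.

Let measurable_rot (b : R) : measurable_fun [set: R] (fun t => frac (t + b)).
Proof. by apply: (measurableT_comp measurable_frac); exact: measurable_shift. Qed.

Let leb01_rot01 (b : R) (A : set R) : 0 <= b < 1 -> measurable A ->
  leb01 ((fun t => frac (t + b)) @^-1` A) = leb01 A.
Proof.
move=> /andP[b0 b1] mA.
rewrite -[LHS]/(lebesgue_measure
  ((fun t => frac (t + b)) @^-1` A `&` `[0%R, 1%R[)).
rewrite -[RHS]/(lebesgue_measure (A `&` `[0%R, 1%R[)).
have -> : (fun t => frac (t + b)) @^-1` A `&` `[0, 1[ =
    (fun t => t + b) @^-1` (A `&` `[b, 1[) `|`
    (fun t => t + (b - 1)) @^-1` (A `&` `[0, b[).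
  apply/seteqP; split => t /=; rewrite !in_itv/=.
  - move=> [At /andP[t0 t1]]; have [tb|tb] := ltP (t + b) 1.
    + left; rewrite (@frac_def _ 0) in At; last by rewrite /= add0r; lra.
      by rewrite subr0 in At; split => //; lra.
    + right; rewrite (@frac_def _ 1) in At; last first.
        by rewrite (_ : (1 + 1 : int) = 2)// -pmulrn; lra.
      by rewrite addrA; split => //; lra.
  - move=> [[At tb]|[At tb]].
    + split; last by lra.
      by rewrite (@frac_def _ 0) ?subr0//= add0r; lra.
    + split; last by lra.
      rewrite (@frac_def _ 1) -?addrA//.
      by rewrite (_ : (1 + 1 : int) = 2)// -pmulrn; lra.
have mA1 : measurable (A `&` `[b, 1[) by exact: measurableI.
have mA2 : measurable (A `&` `[0, b[) by exact: measurableI.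
have pre c B : measurable B -> measurable ((fun t : R => t + c) @^-1` B).
  by move=> mB; rewrite -[X in measurable X]setTI; exact: measurable_shift.
rewrite measureU; [|exact: pre|exact: pre|]; last first.
  apply/seteqP; split => t //=; rewrite !in_itv/= => -[[_ h1] [_ h2]].
  by lra.
transitivity (lebesgue_measure (A `&` `[b, 1%R[)
    + lebesgue_measure (A `&` `[0%R, b[))%E.
  by congr (_ + _)%E; exact: lebesgue_measure_shift.
rewrite -measureU//; last first.
  apply/seteqP; split => t //=; rewrite !in_itv/= => -[[_ h1] [_ h2]].
  by lra.
congr lebesgue_measure; rewrite -setIUr; congr (_ `&` _).
by apply/seteqP; split => t /=; rewrite !in_itv/=; [case; lra|];
  have [?|?] := ltP t b; [right|left]; lra.
Qed.

Lemma leb01_rot (b : R) (A : set R) : measurable A ->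
  leb01 ((fun t => frac (t + b)) @^-1` A) = leb01 A.
Proof.
move=> mA; rewrite -(@leb01_rot01 (frac b) A) ?frac_ge0 ?frac_lt1//.
congr (leb01 _); apply/seteqP; split => t /=.
  by rewrite -(fracDz _ (- Num.floor b)) intrN -addrA.
by rewrite -(fracDz (t + b) (- Num.floor b)) intrN -addrA.
Qed.

Lemma ae_rot (b : R) (P : set (measurableTypeR R)) : (\forall t \ae leb01, P t) ->
  \forall t \ae leb01, P (frac (t + b)).
Proof.
move=> [A [mA A0 PA]]; exists ((fun t => frac (t + b)) @^-1` A); split.
- by rewrite -[X in measurable X]setTI; exact: measurable_rot.
- by rewrite -A0; exact: leb01_rot.
- by move=> t /= nP; exact: PA.
Qed.

Lemma integral_rot (b : R) (h : R -> \bar R) : measurable_fun [set: R] h ->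
  (forall t, 0 <= h t)%E ->
  (\int[leb01]_t h (frac (t + b)%R) = \int[leb01]_t h t)%E.
Proof.
move=> mh h0.
pose rot : measurableTypeR R -> measurableTypeR R := fun t => frac (t + b).
have mrot : measurable_fun setT rot by exact: measurable_rot.
transitivity (\int[pushforward leb01 rot]_t h t)%E.
  by rewrite ge0_integral_pushforward.
pose m : {measure set (measurableTypeR R) -> \bar R} :=
  measure_function_pushforward__canonical__measure_function_Measure leb01 mrot.
apply: (@eq_measure_integral _ (measurableTypeR R) R setT leb01 m).
by move=> A mA _; exact: leb01_rot.
Qed.

End rotation.

Section bishop_operator.
Context {R : realType}.
Variables (p : R) (p1 : 1 <= p).

Definition Lp01 : Type := cLspace (@leb01 R) p1.
HB.instance Definition _ := NormedModule.on Lp01.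

Implicit Types (alpha b t : R) (f g : cLfunType (@leb01 R) p1).

Let wrot (w : R -> R) b (f : R -> R[i]) (t : R) : R[i] :=
  (w t)%:C * f (frac (t + b)).

Let wrot_le (w : R -> R) b (f : R -> R[i]) : measurable_fun [set: R] w ->
  (forall t, 0 <= t < 1 -> 0 <= w t <= 1) ->
  f \in cLfun (@leb01 R) p1 ->
  wrot w b f \in cLfun (@leb01 R) p1 /\
  (cLnorm leb01 p (wrot w b f) <= cLnorm leb01 p f)%E.
Proof.
move=> mw w01 /set_mem[mf lf].
pose rot : measurableTypeR R -> measurableTypeR R := fun t => frac (t + b).
have mrot : measurable_fun setT rot.
  by apply: (measurableT_comp measurable_frac); exact: measurable_funD.
have mfr : cmeasurable (f \o rot).
  by case: mf => fr fi; split;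
    [exact: (measurableT_comp fr mrot)|exact: (measurableT_comp fi mrot)].
have mwf : cmeasurable (wrot w b f : measurableTypeR R -> R[i]).
  by apply: cmeasurableM => //; exact: cmeasurable_real.
have frE : cLnorm leb01 p (f \o rot) = cLnorm leb01 p f.
  rewrite !cLnormE; apply: (congr1 (fun x => (x `^ p^-1)%E)).
  apply: (@integral_rot _ b (fun t => (normc (f t) `^ p)%:E)).
    exact: (measurable_normc_powR p mf).
  by move=> t; rewrite lee_fin powR_ge0.
have le : (cLnorm leb01 p (wrot w b f) <= cLnorm leb01 p f)%E.
  rewrite -frE; apply: le_cLnorm => //.
  apply: leb01_ae => t /w01 /andP[w0 w1].
  rewrite normcM /= expr0n addr0 sqrtr_sqr ger0_norm//.
  by rewrite ler_piMl// normc_ge0.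
by split => //; apply: mem_set; split => //; exact: le_lt_trans lf.
Qed.

Definition bishop_fun alpha (f : R -> R[i]) : R -> R[i] :=
  fun t => t%:C * f (frac (t + alpha)).

Definition bishop_adj_fun alpha (g : R -> R[i]) : R -> R[i] :=
  fun t => (frac (t - alpha))%:C * g (frac (t - alpha)).

Let bishop_fun_le alpha f : bishop_fun alpha f \in cLfun (@leb01 R) p1 /\
  (cLnorm leb01 p (bishop_fun alpha f) <= cLnorm leb01 p f)%E.
Proof.
apply: (@wrot_le id alpha); last exact: cLfunP; first exact: measurable_id.
by move=> t /andP[t0 /ltW t1]; apply/andP.
Qed.

Let bishop_adj_fun_le alpha f :
  bishop_adj_fun alpha f \in cLfun (@leb01 R) p1 /\
  (cLnorm leb01 p (bishop_adj_fun alpha f) <= cLnorm leb01 p f)%E.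
Proof.
apply: (@wrot_le (fun t => frac (t - alpha)) (- alpha)); last exact: cLfunP.
  by apply: (measurableT_comp measurable_frac); exact: measurable_funD.
by move=> t _; rewrite frac_ge0 ltW// frac_lt1.
Qed.

Definition bishop_Lfun alpha f : cLfunType (@leb01 R) p1 :=
  CLfun (bishop_fun_le alpha f).1.

Definition bishop_adj_Lfun alpha f : cLfunType (@leb01 R) p1 :=
  CLfun (bishop_adj_fun_le alpha f).1.

(* These act on a representative of the class; bishop_pi and bishop_adj_pi below
   show that the result does not depend on it. *)
Definition bishop_map alpha (F : Lp01) : Lp01 :=
  \pi_(cLspace (@leb01 R) p1) (bishop_Lfun alpha (repr F)).

Definition bishop_adj_map alpha (F : Lp01) : Lp01 :=
  \pi_(cLspace (@leb01 R) p1) (bishop_adj_Lfun alpha (repr F)).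

Local Notation pi := (\pi_(cLspace (@leb01 R) p1)).

Lemma bishop_map_pi alpha f : bishop_map alpha (pi f) = pi (bishop_Lfun alpha f).
Proof.
apply/cLspace_eqP; have := ae_rot alpha (repr_cLspace f).
apply: (@filterS _ _ (ae_filter_ringOfSetsType leb01)) => t /= ft.
by rewrite /= /bishop_fun ft.
Qed.

Lemma bishop_adj_map_pi alpha f :
  bishop_adj_map alpha (pi f) = pi (bishop_adj_Lfun alpha f).
Proof.
apply/cLspace_eqP; have := ae_rot (- alpha) (repr_cLspace f).
apply: (@filterS _ _ (ae_filter_ringOfSetsType leb01)) => t /= ft.
by rewrite /= /bishop_adj_fun ft.
Qed.

Lemma bishop_map_is_linear alpha : linear (bishop_map alpha).
Proof.
move=> a; elim/quotW => f; elim/quotW => g.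
rewrite -[a *: _]/(cLscale _ _) -(pi_cLspaceZ a f) -(pi_cLspaceD (a *: f) g).
rewrite !bishop_map_pi -[a *: pi _]/(cLscale _ _).
rewrite -(pi_cLspaceZ a (bishop_Lfun alpha f)).
rewrite -(pi_cLspaceD _ (bishop_Lfun alpha g)).
congr pi; apply/val_inj/funext => t.
rewrite -[LHS]/(t%:C * (a * f (frac (t + alpha)) + g (frac (t + alpha)))).
rewrite -[RHS]/(a * (t%:C * f (frac (t + alpha)))
  + t%:C * g (frac (t + alpha))).
by rewrite mulrDr mulrCA.
Qed.

Lemma bishop_adj_map_is_linear alpha : linear (bishop_adj_map alpha).
Proof.
move=> a; elim/quotW => f; elim/quotW => g.
rewrite -[a *: _]/(cLscale _ _) -(pi_cLspaceZ a f) -(pi_cLspaceD (a *: f) g).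
rewrite !bishop_adj_map_pi -[a *: pi _]/(cLscale _ _).
rewrite -(pi_cLspaceZ a (bishop_adj_Lfun alpha f)).
rewrite -(pi_cLspaceD _ (bishop_adj_Lfun alpha g)).
congr pi; apply/val_inj/funext => t.
set u := frac (t - alpha).
rewrite -[LHS]/(u%:C * (a * f u + g u)) -[RHS]/(a * (u%:C * f u) + u%:C * g u).
by rewrite mulrDr mulrCA.
Qed.

HB.instance Definition _ alpha :=
  GRing.isLinear.Build R[i] Lp01 Lp01 *:%R (bishop_map alpha)
    (bishop_map_is_linear alpha).
HB.instance Definition _ alpha :=
  GRing.isLinear.Build R[i] Lp01 Lp01 *:%R (bishop_adj_map alpha)
    (bishop_adj_map_is_linear alpha).

Definition bishop alpha : {linear Lp01 -> Lp01} := bishop_map alpha.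

Definition bishop_adj alpha : {linear Lp01 -> Lp01} := bishop_adj_map alpha.

Lemma bishop_pi alpha f : bishop alpha (pi f) = pi (bishop_Lfun alpha f).
Proof. exact: bishop_map_pi. Qed.

Lemma bishop_adj_pi alpha f :
  bishop_adj alpha (pi f) = pi (bishop_adj_Lfun alpha f).
Proof. exact: bishop_adj_map_pi. Qed.

Lemma ler_norm_bishop alpha (F : Lp01) : `|bishop alpha F| <= `|F|.
Proof.
elim/quotW: F => f; rewrite bishop_pi.
rewrite -[X in X <= _]/(cLspace_norm (pi (bishop_Lfun alpha f))).
rewrite -[X in _ <= X]/(cLspace_norm (pi f)) !cLspace_norm_pi lecR.
by rewrite fine_le ?cLnorm_fin// (bishop_fun_le alpha f).2.
Qed.

Lemma ler_norm_bishop_adj alpha (F : Lp01) : `|bishop_adj alpha F| <= `|F|.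
Proof.
elim/quotW: F => f; rewrite bishop_adj_pi.
rewrite -[X in X <= _]/(cLspace_norm (pi (bishop_adj_Lfun alpha f))).
rewrite -[X in _ <= X]/(cLspace_norm (pi f)) !cLspace_norm_pi lecR.
by rewrite fine_le ?cLnorm_fin// (bishop_adj_fun_le alpha f).2.
Qed.

Lemma bishop_continuous alpha : continuous (bishop alpha).
Proof.
apply: bounded_linear_continuous; apply/linear_boundedP.
near=> r => F; apply: le_trans (ler_norm_bishop alpha F) _.
by rewrite ler_peMl.
Unshelve. all: by end_near. Qed.

Lemma bishop_adj_continuous alpha : continuous (bishop_adj alpha).
Proof.
apply: bounded_linear_continuous; apply/linear_boundedP.
near=> r => F; apply: le_trans (ler_norm_bishop_adj alpha F) _.
by rewrite ler_peMl.
Unshelve. all: by end_near. Qed.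

End bishop_operator.

Arguments bishop {R p} p1 alpha.
Arguments bishop_adj {R p} p1 alpha.

Section local_spectrum.
Context {R : realType} {X : normedModType R[i]}.
Variable T : {linear X -> X}.

(* Functions U -> X are represented by total functions, since the conditions
   below only involve the values of f on the open set U. As the scalar field is
   R[i], derivability in the direction 1 is complex differentiability, so that f
   is analytic on U when it holds at every point of U. *)
Definition local_resolvent (x : X) : set R[i] :=
  [set lambda | exists (U : set R[i]) (f : R[i] -> X),
    [/\ open_nbhs lambda U,
        forall z, U z -> derivable f z 1
      & forall z, U z -> T (f z) - z *: f z = x]].

Definition local_spectrum (x : X) : set R[i] := ~` local_resolvent x.

Definition local_spectral_subspace (F : set R[i]) : set X :=
  [set x | local_spectrum x `<=` F].

Definition Dunford_property_C : Prop :=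
  forall F : set R[i], closed F -> closed (local_spectral_subspace F).

End local_spectrum.

(* Main.v *)
(* On the dense set of bounded $x$ supported where the orbit under the rotation
   does not approach 0 too fast, the weighted rotation
   $S f(t) = \{t + a\} f(\{t + b\})$ can be iterated backwards with
   $\|S^{-n} x\|_\infty = e^{n + o(n)}$, while $\|S^n x\|_\infty \le e^{-n + o(n)}$
   holds for every bounded $x$. Hence $\sum_n z^n S^{-n-1} x$ and
   $- \sum_n z^{-n-1} S^n x$ are local resolvents inside and outside the circle
   $|z| = e^{-1}$. Both rates come from the Birkhoff sums of $\ln$: replacing
   $\ln x$ by $\ln (x + s^2)$ makes them converge uniformly, and the error is at most
   $4 s$ times a Birkhoff sum of the derivative of the square root, which the maximal
   ergodic inequality controls outside a set of small measure. The series are summed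
   pointwise, so that completeness of $L^p$ is not needed.

   The operators are $S$ for $(a, b) = (0, \alpha)$ and
   $(a, b) = (- \alpha, - \alpha)$. Property (C) fails because the constant 1 is not
   in their range ($1/t$ is not in $L^p$), so that 0 lies in its local spectrum. *)
Require Import Defs.
From mathcomp Require Import all_boot all_order all_algebra.
From mathcomp Require Import all_classical all_reals all_analysis measurable_realfun.
From mathcomp Require Import complex ring lra.

Set Implicit Arguments.
Unset Strict Implicit.
Unset Printing Implicit Defensive.
Import Order.TTheory GRing.Theory Num.Theory.
Import numFieldNormedType.Exports.
Import Normc.

Local Open Scope classical_set_scope.
Local Open Scope ring_scope.
Local Open Scope complex_scope.
Local Open Scope quotient_scope.

Local Notation frac := Defs.frac.

(** * Orbits of irrational rotations *)

Section fractional_part.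
Context {R : realType}.
Implicit Types x y : R.

Lemma frac_id x : 0 <= x < 1 -> frac x = x.
Proof. by move=> x01; rewrite (@frac_def _ _ 0) ?subr0//= add0r. Qed.

Lemma fracE x : exists m : int, frac x = x + m%:~R.
Proof. by exists (- Num.floor x); rewrite intrN. Qed.

Lemma fracDl x y : frac (frac x + y) = frac (x + y).
Proof. by have [m ->] := fracE x; rewrite addrAC fracDz. Qed.

Lemma fracDr x y : frac (x + frac y) = frac (x + y).
Proof. by rewrite addrC fracDl addrC. Qed.

Lemma fracMn x n : frac (frac x *+ n) = frac (x *+ n).
Proof.
have [m ->] := fracE x.
by rewrite mulrnDl -rmorphMn/= fracDz.
Qed.

Lemma frac_irrational_neq0 x n : irrational x -> (0 < n)%N -> frac (x *+ n) != 0.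
Proof.
move=> xi n0; apply/eqP => /eqP; rewrite /frac subr_eq0 => /eqP xn.
apply: xi; exists ((Num.floor (x *+ n))%:~R / n%:R) => //.
rewrite fmorph_div/= ratr_int ratr_nat -xn -(mulr_natr x) mulfK//.
by rewrite pnatr_eq0 -lt0n.
Qed.

(* Let t = frac (x *+ n) and m t <= 1 < (m + 1) t. Either the overshoot
   (m + 1) t - 1 is at most t / 2, or w = 1 - m t is less than t / 2; in the second
   case the multiples of - w modulo 1 end in an interval of length w above 0. *)
Lemma frac_halving x n : irrational x -> (0 < n)%N ->
  exists2 k, (0 < k)%N & frac (x *+ k) <= frac (x *+ n) / 2.
Proof.
move=> xi n0; set t := frac (x *+ n).
have t0 : 0 < t by rewrite lt_neqAle frac_ge0 eq_sym frac_irrational_neq0.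
have t1 : t < 1 := frac_lt1 _.
have multiple (u : R) : 0 < u -> exists m : nat, m%:R * u <= 1 < m.+1%:R * u.
  move=> u0; exists (Num.truncn u^-1).
  by rewrite -ler_pdivlMr// -ltr_pdivrMr// div1r truncn_itv// invr_ge0 ltW.
have [m /andP[mt m1t]] := multiple t t0.
have m0 : (0 < m)%N by case: m mt m1t => //; lra.
have E k : frac (x *+ (n * k)) = frac (t * k%:R).
  by rewrite mulrnA -fracMn mulr_natr.
have [le|gt] := leP (m.+1%:R * t - 1) (t / 2).
  exists (n * m.+1)%N; first by rewrite muln_gt0 n0.
  rewrite E (@frac_def _ _ 1) mulrC//.
  rewrite (_ : (1 + 1 : int) = 2)// -pmulrn (ltW m1t)/=.
  by rewrite -(natr1 m); lra.
have mt1 : m%:R * t != 1.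
  apply/eqP => mt1; have := @frac_irrational_neq0 x (n * m) xi.
  rewrite muln_gt0 n0 m0 => /(_ isT); rewrite E mulrC mt1.
  by rewrite -[X in frac X]add0r (fracDz 0 1) frac_id ?eqxx ?lexx ?ltr01.
have [w wE] : exists w, w = 1 - m%:R * t by exists (1 - m%:R * t).
have w0 : 0 < w by rewrite wE subr_gt0 lt_neqAle mt1.
have wt : w < t / 2 by move: gt; rewrite wE -(natr1 m); lra.
have [k /andP[kw k1w]] := multiple w w0.
have k0 : (0 < k)%N by case: k kw k1w => //; lra.
exists (n * m * k)%N; first by rewrite !muln_gt0 n0 m0.
have -> : frac (x *+ (n * m * k)) = 1 - k%:R * w.
  rewrite -mulnA E natrM mulrA.
  rewrite (_ : t * m%:R * k%:R = (1 - k%:R * w) + (k.-1%:Z)%:~R).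
    rewrite fracDz frac_id//; apply/andP; split; first lra.
    by rewrite ltrBlDr ltrDl mulr_gt0// ltr0n.
  by rewrite wE -[k in LHS](prednK k0) -[k in RHS](prednK k0) -(natr1 k.-1) -pmulrn/=; ring.
by move: k1w wt; rewrite -(natr1 k); lra.
Qed.

(** Iterating [frac_halving] gives fractional parts at most 2^-k; irrationality keeps them off 0. *)
Lemma frac_small x e : irrational x -> 0 < e ->
  exists2 n, (0 < n)%N & 0 < frac (x *+ n) < e.
Proof.
move=> xi e0.
have small : forall k, exists2 n, (0 < n)%N & frac (x *+ n) <= 2^-1 ^+ k.
  elim=> [|k [n n0 nk]]; first by exists 1%N => //; rewrite expr0 ltW// frac_lt1.
  have [m m0 mn] := frac_halving xi n0; exists m => //; apply: le_trans mn _.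
  by rewrite exprSr ler_pM2r ?invr_gt0.
have [n n0 ne] := small (Num.bound e^-1).
exists n => //; rewrite lt_neqAle frac_ge0 eq_sym frac_irrational_neq0//=.
apply: le_lt_trans ne _; rewrite exprVn invf_plt ?posrE// ?exprn_gt0//.
have /archi_boundP : 0 <= e^-1 by rewrite invr_ge0 ltW.
move/lt_trans; apply.
by rewrite -natrX ltr_nat ltn_expl.
Qed.

Lemma measurable_fracD x : measurable_fun [set: R] (fun t => frac (t + x)).
Proof. by apply: (measurableT_comp measurable_frac); exact: measurable_funD. Qed.

End fractional_part.

(** * Uniform bounds for Birkhoff sums over an irrational rotation *)

Section rotation_sums.
Context {R : realType}.
Implicit Types (b x : R) (phi P F f : R -> R).

(* Since be is q rotations modulo 1, the sum of the increments of P along the orbit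
   telescopes to 2q of its values. *)
Lemma rotation_sum_le b phi P (I be C : R) q : 0 < be -> frac (b *+ q) = be ->
  (forall x, `|P (frac x)| <= C) ->
  (forall x, be * phi (frac x) <= be * I + (P (frac (x + be)) - P (frac x))) ->
  forall n x, \sum_(j < n) phi (frac (x + b *+ j)) <= n%:R * I + 2 * q%:R * C / be.
Proof.
move=> be0 qbe PC phiP n x; pose u k := P (frac (x + b *+ k)).
(* The first n + q values are summed in two ways, cut after n and after q terms. *)
have tele : \sum_(j < n) (u (q + j)%N - u j) = \sum_(i < q) (u (n + i)%N - u i).
  have E m k : \sum_(i < m + k) u i = \sum_(i < m) u i + \sum_(i < k) u (m + i)%N.
    by rewrite big_split_ord.
  by have := E q n; rewrite addnC E !sumrB; lra.
rewrite -(ler_pM2l be0) mulr_sumr.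
apply: (@le_trans _ _ (\sum_(j < n) (be * I + (u (q + j)%N - u j)))).
  apply: ler_sum => j _; rewrite /u.
  have -> : frac (x + b *+ (q + j)) = frac (x + b *+ j + be).
    by rewrite -qbe fracDr mulrnDr addrCA addrC.
  exact: phiP.
rewrite big_split/= sumr_const card_ord tele mulrDr -[be * I *+ n]mulr_natl mulrCA lerD2l.
apply: (@le_trans _ _ (\sum_(i < q) (C + C))).
  apply: ler_sum => i _; apply: le_trans (ler_norm _) _.
  by apply: le_trans (ler_normB _ _) _; apply: lerD; exact: PC.
rewrite sumr_const card_ord -mulr_natl le_eqVlt; apply/orP; left; apply/eqP.
by field; rewrite gt_eqF.
Qed.

(* tangent says that F is convex with derivative f, so that [F 1 - F 0] is the
   integral of f over [0, 1]. *)
Section convex.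
Variables (f F : R -> R) (M : R).
Hypothesis tangent : forall x y : R, 0 <= x <= 1 -> 0 <= y <= 1 ->
  f x * (y - x) <= F y - F x.
Hypothesis fM : forall x : R, 0 <= x <= 1 -> `|f x| <= M.

Let o0 : 0 <= (0 : R) <= 1.
Proof. by apply/andP; split => //; exact: ler01. Qed.

Let o1 : 0 <= (1 : R) <= 1.
Proof. by apply/andP; split => //; exact: ler01. Qed.

Let M0 : 0 <= M.
Proof. exact: le_trans (normr_ge0 _) (fM o0). Qed.

Let frac01 (x : R) : 0 <= frac x <= 1.
Proof. by rewrite frac_ge0 ltW// frac_lt1. Qed.

Let FM x : 0 <= x <= 1 -> `|F x| <= `|F 0| + M.
Proof.
move=> x01.
have := tangent x01 o0; have := tangent o0 x01.
have := fM x01; have := fM o0; rewrite !ler_norml.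
have := ler_norm (F 0); have := ler_norm (- F 0); rewrite normrN.
case/andP: x01 => x0 x1 *; apply/andP; split; nra.
Qed.

Let bounded_dev I x : `|F (frac x) - I * frac x| <= `|F 0| + M + `|I|.
Proof.
apply: le_trans (ler_normB _ _) _; apply: lerD; first exact: FM.
by rewrite normrM ler_piMr// ger0_norm ?frac_ge0// ltW// frac_lt1.
Qed.

(** Some multiple of [b] is a small step [be] modulo 1. By the tangent inequality [be * f] is at
    most the increment of [F] over that step, and subtracting a linear function makes [F] periodic
    up to a small jump, so that [rotation_sum_le] applies. *)
Lemma rotation_sum_convex_le b e : irrational b -> 0 < e ->
  exists C, forall n x,
    \sum_(j < n) f (frac (x + b *+ j)) <= n%:R * (F 1 - F 0 + e) + C.
Proof.
move=> bi e0.
have [|q q0] := frac_small bi (_ : 0 < e / (2 * M + 1)).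
  by rewrite divr_gt0// ltr_wpDl// mulr_ge0.
have [be qbe] : exists be, frac (b *+ q) = be by eexists.
rewrite qbe ltr_pdivlMr ?ltr_wpDl ?mulr_ge0// => /andP[be0 bee].
have be1 : be < 1 by rewrite -qbe frac_lt1.
(* The slack [2 * M * be], less than [e], pays for a step that wraps around 1: there the tangents at
   [y] (up to 1) and at 0 (up to [y + be - 1]) are combined, and replacing [f 0] by [f y] costs at
   most [2 * M * be]. *)
pose I := F 1 - F 0 + 2 * M * be.
pose P x := F x - I * x.
have := @rotation_sum_le b f P I be _ q be0 qbe (bounded_dev I).
move=> H; exists (2 * q%:R * (`|F 0| + M + `|I|) / be) => n x.
apply: le_trans (H _ n x) _; last first.
  by rewrite lerD2r ler_wpM2l// /I; nra.
move=> {H n}x; rewrite /P.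
have y01 := frac01 x; set y := frac x in y01 *.
have yx : frac (x + be) = frac (y + be) by rewrite /y fracDl.
have fy := fM y01; have f0 := fM o0; rewrite !ler_norml in fy f0.
have [ybe|ybe] := ltP (y + be) 1.
  have z01 : 0 <= y + be <= 1 by move: y01; lra.
  rewrite yx frac_id; last by move: y01; lra.
  have := tangent y01 z01; rewrite (addrC y) addrK; lra.
have yz : frac (y + be) = y + be - 1.
  by apply: (@frac_def _ _ 1); rewrite (_ : (1 + 1 : int) = 2)// -pmulrn; move: y01; lra.
have z01 : 0 <= y + be - 1 <= 1 by move: y01; lra.
rewrite yx yz.
have := tangent y01 o1; have := tangent o0 z01; rewrite subr0 /I.
move: y01 fy f0 => /andP[? ?] /andP[? ?] /andP[? ?] *.
nra.
Qed.

(** Convexity bounds [f] from below by increments of [F] over a step to the left. Hence the argument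
    runs for [- f], with a [P] that is shifted by [be]. *)
Lemma rotation_sum_convex_ge b e : irrational b -> 0 < e ->
  exists C, forall n x,
    n%:R * (F 1 - F 0 - e) - C <= \sum_(j < n) f (frac (x + b *+ j)).
Proof.
move=> bi e0.
have [|q q0] := frac_small bi (_ : 0 < e / (2 * M + 1)).
  by rewrite divr_gt0// ltr_wpDl// mulr_ge0.
have [be qbe] : exists be, frac (b *+ q) = be by eexists.
rewrite qbe ltr_pdivlMr ?ltr_wpDl ?mulr_ge0// => /andP[be0 bee].
have be1 : be < 1 by rewrite -qbe frac_lt1.
pose I := F 1 - F 0 - 2 * M * be.
pose P x := - (F (frac (x - be)) - I * frac (x - be)).
have PC x : `|P (frac x)| <= `|F 0| + M + `|I|.
  by rewrite normrN; exact: bounded_dev.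
have := @rotation_sum_le b (\- f) P (- I) be _ q be0 qbe PC.
move=> H; exists (2 * q%:R * (`|F 0| + M + `|I|) / be) => n x.
rewrite -lerN2 -sumrN; apply: le_trans (H _ n x) _; last first.
  rewrite [leRHS]opprD opprK lerD2r -mulrN ler_wpM2l// /I; nra.
move=> {H n}x; rewrite /P !fracDl addrK.
have y01 := frac01 x; set y := frac x in y01 *.
have yx : frac (x - be) = frac (y - be) by rewrite /y fracDl.
have fy := fM y01; have f1 := fM o1; rewrite !ler_norml in fy f1.
have [ybe|ybe] := leP be y.
  have z01 : 0 <= y - be <= 1 by move: y01; lra.
  rewrite yx frac_id; last by move: y01; lra.
  have := tangent y01 z01; rewrite /=; lra.
have yz : frac (y - be) = y - be + 1.
  rewrite -(@fracDz _ (y - be) 1) frac_id//; move: y01; lra.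
have z01 : 0 <= y - be + 1 <= 1 by move: y01; lra.
rewrite yx yz.
have := tangent y01 o0; have := tangent o1 z01; rewrite /I/=.
move: y01 fy f1 => /andP[? ?] /andP[? ?] /andP[? ?] *.
nra.
Qed.

End convex.
End rotation_sums.

(** * Growth of the products along an orbit *)

Section cocycle.
Context {R : realType}.
Implicit Types (a b c e s t u v x : R).

Lemma ln_leB1 u : 0 < u -> ln u <= u - 1.
Proof.
move=> u0; have := @le_ln1Dx R (u - 1).
by rewrite [1 + _]addrC subrK ltrBrDr addNr => /(_ u0).
Qed.

(** The tangent inequality of the convex function u ln u - u, an antiderivative of [ln]. It reduces
    to ln w <= w - 1 at w = (x + c) / (y + c). *)
Lemma ln_shift_tangent c x y : 0 < c -> 0 <= x -> 0 <= y ->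
  ln (x + c) * (y - x) <=
  ((y + c) * ln (y + c) - (y + c)) - ((x + c) * ln (x + c) - (x + c)).
Proof.
move=> c0 x0 y0; have u0 : 0 < x + c by lra.
have v0 : 0 < y + c by lra.
have : (y + c) * (ln (x + c) - ln (y + c)) <= x - y.
  rewrite -ln_div ?posrE// mulrC -ler_pdivlMr//.
  apply: le_trans (ln_leB1 _) _; first by rewrite divr_gt0.
  by rewrite le_eqVlt; apply/orP; left; apply/eqP; field; rewrite gt_eqF.
by move=> h; lra.
Qed.

Lemma ln_shift_bounded c x : 0 < c -> 0 <= x <= 1 ->
  `|ln (x + c)| <= `|ln c| + `|ln (1 + c)|.
Proof.
move=> c0 /andP[x0 x1].
have h1 : ln c <= ln (x + c) by rewrite ler_ln ?posrE; lra.
have h2 : ln (x + c) <= ln (1 + c) by rewrite ler_ln ?posrE; lra.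
have := ler_norm (- ln c); have := ler_norm (ln (1 + c)); rewrite normrN => *.
have := normr_ge0 (ln c); have := normr_ge0 (ln (1 + c)) => *.
by rewrite ler_norml; apply/andP; split; lra.
Qed.

(* The middle term is $\int_0^1 \ln (x + s^2) dx$. *)
Lemma ln_shift_mean s : 0 < s <= 1 / 2 ->
  - 1 <= ((1 + s ^+ 2) * ln (1 + s ^+ 2) - (1 + s ^+ 2)) -
         ((0 + s ^+ 2) * ln (0 + s ^+ 2) - (0 + s ^+ 2)) <= - 1 + 4 * s.
Proof.
move=> /andP[s0 s1]; have c0 : 0 < s ^+ 2 by rewrite exprn_gt0.
(* The delicate term of the mean is - s^2 ln (s^2); this bound makes it at most 2 s. *)
have lns : - ln s <= s^-1 - 1 by rewrite -lnV ?posrE// ln_leB1// invr_gt0.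
have lns1 : ln s <= 0 by apply: ln_le0; lra.
have l1 : 0 <= ln (1 + s ^+ 2) by apply: ln_ge0; lra.
have l2 : ln (1 + s ^+ 2) <= s ^+ 2 by apply: le_ln1Dx; lra.
have ss : s * s^-1 = 1 by rewrite mulfV// gt_eqF.
rewrite add0r lnXn// -mulr_natr expr2.
rewrite expr2 in l1 l2.
move: (ln s) (ln (1 + _)) (s^-1) lns lns1 l1 l2 ss => y z w lns lns1 l1 l2 ss.
apply/andP; split; first by nra.
have : s * s * (1 - w) <= s * s * y by nra.
have : (1 + s * s) * z <= (1 + s * s) * (s * s) by nra.
have : s * s * w = s by rewrite -mulrA ss mulr1.
have : s * s * (s * s) <= s * s by rewrite ler_piMr ?mulr_ge0 ?(ltW s0)//; nra.
lra.
Qed.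

(* The derivative of the square root, with the junk value 0 at 0. *)
Definition dsqrt x := 2^-1 * x `^ (2^-1 - 1).

Lemma dsqrt_ge0 x : 0 <= dsqrt x.
Proof. by rewrite mulr_ge0// powR_ge0. Qed.

(** With r the square root of x, x + s^2 <= (r + s)^2 = x (1 + s / r)^2, so the logarithm grows by
    at most 2 s / r, which is [4 * s * dsqrt x]. *)
Lemma ln_shift_le s x : 0 < s -> 0 < x ->
  ln (x + s ^+ 2) - 4 * s * dsqrt x <= ln x.
Proof.
move=> s0 x0; pose r := x `^ 2^-1; have r0 : 0 < r by rewrite powR_gt0.
have xr : x = r ^+ 2 by rewrite -powR_mulrn ?powR_ge0// -powRrM mulVf// powRr1// ltW.
have -> : dsqrt x = 2^-1 / r.
  rewrite /dsqrt powRB; last by apply/implyP => _; rewrite gt_eqF.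
  by rewrite powRr1 ?ltW// -/r xr; field; rewrite gt_eqF.
have u0 : 0 < 1 + s / r by rewrite ltr_wpDr// divr_ge0// ltW.
have xs0 : 0 < x + s ^+ 2 by rewrite addr_gt0 ?exprn_gt0.
have : ln (x + s ^+ 2) <= ln (r ^+ 2 * (1 + s / r) ^+ 2).
  rewrite ler_ln ?posrE ?xs0 ?mulr_gt0 ?exprn_gt0//.
  rewrite xr -exprMn (_ : r * (1 + s / r) = r + s); first by nra.
  by field; rewrite gt_eqF.
rewrite lnM ?posrE ?exprn_gt0// -xr [ln (_ ^+ 2)]lnXn// => h.
have : ln (1 + s / r) <= s / r.
  by apply: le_ln1Dx; rewrite (@lt_le_trans _ _ 0)// divr_ge0// ltW.
by rewrite -mulr_natr in h *; lra.
Qed.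

(** The weight of the n-th iterate of the weighted rotation: S^n f (t) is [cocycle a b n t] times f
    at {t + n b}. *)
Definition cocycle a b n t := \prod_(j < n) frac (t + a + b *+ j).

Lemma cocycle_frac a b n t : cocycle a b n (frac t) = cocycle a b n t.
Proof.
by apply: eq_bigr => j _; rewrite -[frac t + _ + _]addrA fracDl addrA.
Qed.

Lemma cocycleS a b n t : cocycle a b n.+1 t = frac (t + a) * cocycle a b n (t + b).
Proof.
rewrite /cocycle big_ord_recl mulr0n addr0; congr (_ * _).
by apply: eq_bigr => j _; rewrite mulrS addrA [in RHS](addrAC t).
Qed.

Lemma cocycleSr a b n t :
  cocycle a b n.+1 t = cocycle a b n t * frac (t + a + b *+ n).
Proof. by rewrite /cocycle big_ord_recr. Qed.

Lemma cocycle_ge0 a b n t : 0 <= cocycle a b n t.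
Proof. by apply: prodr_ge0 => j _; exact: frac_ge0. Qed.

Lemma cocycle_le a b e : irrational b -> 0 < e ->
  exists2 C, 0 < C & forall n t, cocycle a b n t <= C * expR (e - 1) ^+ n.
Proof.
(* Adding s^2 to every factor only increases the product. The mean of the shifted logarithm exceeds
   -1 by at most 4 s <= e / 2, and the other e / 2 is left for the error of the Birkhoff sums. *)
move=> bi e0; pose s := Num.min (1 / 2) (e / 8).
have s0 : 0 < s by rewrite lt_min; lra.
have s12 : s <= 1 / 2 by rewrite ge_min lexx.
have se : s <= e / 8 by rewrite ge_min lexx orbT.
pose c := s ^+ 2; have c0 : 0 < c by rewrite exprn_gt0.
pose f x := ln (x + c); pose F x := (x + c) * ln (x + c) - (x + c).
have tangent x y : 0 <= x <= 1 -> 0 <= y <= 1 -> f x * (y - x) <= F y - F x.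
  by move=> /andP[? _] /andP[? _]; exact: ln_shift_tangent.
have e20 : 0 < e / 2 by rewrite divr_gt0.
have [C fC] := rotation_sum_convex_le tangent (fun x => ln_shift_bounded c0) bi e20.
have /andP[_ mean] := @ln_shift_mean s (introT andP (conj s0 s12)).
exists (expR C); first exact: expR_gt0.
move=> n t; apply: (@le_trans _ _ (\prod_(j < n) (frac (t + a + b *+ j) + c))).
  by apply: ler_prod => j _; rewrite frac_ge0/= lerDl ltW.
rewrite (eq_bigr (fun j : 'I_n => expR (f (frac (t + a + b *+ j))))); last first.
  by move=> j _; rewrite lnK// posrE ltr_wpDl// frac_ge0.
rewrite -expR_sum -expRM_natl -expRD ler_expR [X in _ <= X]addrC.
apply: le_trans (fC n (t + a)) _.
rewrite lerD2r ler_wpM2l// /F; rewrite /c in mean *; lra.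
Qed.

(** The sum bound says that the orbit approaches 0 slowly on average. Positivity is a separate
    condition because [dsqrt] is 0 at 0, so that the sum does not detect a visit to 0. *)
Definition tempered a b l t := forall n, 0 < frac (t + a + b *+ n) /\
  \sum_(j < n) dsqrt (frac (t + a + b *+ j)) <= l * n%:R.

(** By [ln_shift_le], passing from the shifted logarithm to [ln] costs at most 4 s l n <= (e / 2) n
    along a tempered orbit. As [s] depends on [l] and [e] only, [C] serves all tempered points at
    once. *)
Lemma cocycle_ge a b l e : irrational b -> 0 < l -> 0 < e ->
  exists2 C, 0 < C &
    forall t, tempered a b l t -> forall n, C * expR (- e - 1) ^+ n <= cocycle a b n t.
Proof.
move=> bi l0 e0; pose s := Num.min (1 / 2) (e / (8 * l)).
have s0 : 0 < s by rewrite lt_min !divr_gt0// mulr_gt0.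
have s12 : s <= 1 / 2 by rewrite ge_min lexx.
have se : 4 * s * l <= e / 2.
  have : s <= e / (8 * l) by rewrite ge_min lexx orbT.
  by rewrite ler_pdivlMr ?mulr_gt0//; lra.
pose c := s ^+ 2; have c0 : 0 < c by rewrite exprn_gt0.
pose f x := ln (x + c); pose F x := (x + c) * ln (x + c) - (x + c).
have tangent x y : 0 <= x <= 1 -> 0 <= y <= 1 -> f x * (y - x) <= F y - F x.
  by move=> /andP[? _] /andP[? _]; exact: ln_shift_tangent.
have e20 : 0 < e / 2 by rewrite divr_gt0.
have [C fC] := rotation_sum_convex_ge tangent (fun x => ln_shift_bounded c0) bi e20.
have /andP[mean _] := @ln_shift_mean s (introT andP (conj s0 s12)).
exists (expR (- C)); first exact: expR_gt0.
move=> t good n; rewrite /cocycle.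
rewrite (eq_bigr (fun j : 'I_n => expR (ln (frac (t + a + b *+ j))))); last first.
  by move=> j _; rewrite lnK// posrE (good j).1.
rewrite -expR_sum -expRM_natl -expRD ler_expR.
apply: (@le_trans _ _ (\sum_(j < n) (f (frac (t + a + b *+ j))
    - 4 * s * dsqrt (frac (t + a + b *+ j))))); last first.
  by apply: ler_sum => j _; apply: ln_shift_le => //; exact: (good j).1.
rewrite sumrB -mulr_sumr.
have h1 := fC n (t + a).
have h2 : 4 * s * \sum_(j < n) dsqrt (frac (t + a + b *+ j)) <= 4 * s * (l * n%:R).
  by rewrite ler_wpM2l ?(good n).2// mulr_ge0// ltW.
have h3 : 4 * s * (l * n%:R) <= e / 2 * n%:R by rewrite mulrA ler_wpM2r.
have h4 : - n%:R <= n%:R * (F 1 - F 0).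
  by rewrite -mulrN1 ler_wpM2l// /F /c; lra.
lra.
Qed.

End cocycle.

(** * Integrability of the derivative of the square root *)

Section integral_dsqrt.
Context {R : realType}.
Local Notation mu := lebesgue_measure.

Lemma measurable_dsqrt : measurable_fun [set: R] (@dsqrt R).
Proof. by apply: measurable_funM => //; exact: measurable_powR. Qed.

Let powR_continuous (r x : R) : 0 < x -> {for x, continuous (@powR R ^~ r)}.
Proof.
move=> x0; apply/differentiable_continuous/derivable1_diffP.
by apply: derivable_powR; rewrite in_itv/= x0.
Qed.

Let integral_dsqrt_itv (a : R) : 0 < a < 1 ->
  (\int[mu]_(x in `[a, 1%R]) (dsqrt x)%:E = (1 - a `^ 2^-1)%:E)%E.
Proof.
move=> /andP[a0 a1].
rewrite (@continuous_FTC2 _ _ (@powR R ^~ 2^-1))//.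
- by rewrite powR1 -EFinB.
- apply: continuous_in_subspaceT => x; rewrite inE/= in_itv/= => /andP[ax _].
  apply: cvgM; first exact: cvg_cst.
  by apply: powR_continuous; exact: lt_le_trans ax.
- split.
  + move=> x; rewrite in_itv/= => /andP[ax _].
    by apply: derivable_powR; rewrite in_itv/= (lt_trans a0).
  + by apply: cvg_at_right_filter; exact: powR_continuous.
  + by apply: cvg_at_left_filter; exact: powR_continuous.
- move=> x; rewrite in_itv/= => /andP[ax _].
  by rewrite powR_derive1// in_itv/= (lt_trans a0).
Qed.

Lemma integral_dsqrt : (\int[mu]_(x in `[0%R, 1%R]) (dsqrt (x : R))%:E <= 1)%E.
Proof.
have mds D : measurable D -> measurable_fun D (EFin \o @dsqrt R).
  by move=> mD; apply/measurable_EFinP; apply: measurable_funTS; exact: measurable_dsqrt.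
rewrite -integral_itv_obnd_cbnd; last exact: mds.
(* The fundamental theorem of calculus is used away from the singularity at 0, then monotone
   convergence. The index [n.+2] keeps the left endpoint strictly below 1. *)
pose F n := `[(n.+2%:R : R)^-1, 1]%classic.
have FU : `]0, 1]%classic = \bigcup_n F n.
  apply/seteqP; split=> [x /=|x [n _]]; rewrite /F/= !in_itv/=.
    move=> /andP[x0 x1]; exists (Num.bound x^-1) => //=.
    rewrite /F/= in_itv/= x1 andbT invf_ple ?posrE//.
    apply/ltW/(lt_trans (archi_boundP _)); first by rewrite invr_ge0 ltW.
    by rewrite ltr_nat.
  by move=> /andP[nx ->]; rewrite andbT (lt_le_trans _ nx).
have h := @ge0_nondecreasing_set_cvg_integral _ (measurableTypeR R) R F (EFin \o @dsqrt R) mu.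
have {}h : ((\int[mu]_(x in F i) (EFin \o @dsqrt R) x)%E @[i --> \oo]
    --> (\int[mu]_(x in \bigcup_i F i) (EFin \o @dsqrt R) x)%E).
  apply: h => [m n mn|i|i|i x _].
  - apply/subsetPset => x; rewrite /F/= !in_itv/= => /andP[mx ->]; rewrite andbT.
    by apply: le_trans mx; rewrite lef_pV2 ?posrE// ler_nat.
  - exact: measurable_itv.
  - by apply: mds; exact: measurable_itv.
  - by rewrite lee_fin dsqrt_ge0.
rewrite FU -(cvg_lim _ h)//; apply: lime_le; first by apply/cvg_ex; eexists; exact: h.
apply: nearW => n; rewrite integral_dsqrt_itv ?lee_fin ?gerBl ?powR_ge0//.
by rewrite invr_gt0 ltr0n/= invf_lt1 ?ltr0n// ltr1n.
Qed.

Lemma leb01_integral_dsqrt (a : R) :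
  (\int[leb01]_t (dsqrt (frac (t + a)))%:E <= 1)%E.
Proof.
rewrite (@integral_rot _ a (EFin \o @dsqrt R)); last 2 first.
- by apply/measurable_EFinP; exact: measurable_dsqrt.
- by move=> t; rewrite lee_fin dsqrt_ge0.
apply: le_trans integral_dsqrt.
have mds : measurable_fun setT (EFin \o @dsqrt R).
  by apply/measurable_EFinP; exact: measurable_dsqrt.
have ds0 x : (0 <= (EFin \o @dsqrt R) x)%E by rewrite lee_fin dsqrt_ge0.
rewrite (@ge0_negligible_integral _ (measurableTypeR R) _ leb01 setT (~` `[0%R, 1%R[%classic))//;
  last 2 first.
- exact: measurableC.
- by rewrite -[LHS]/(lebesgue_measure _) setICl measure0.
rewrite setTD setCK (@eq_measure_integral _ _ _ _ lebesgue_measure)//; last first.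
  move=> A mA A01; rewrite -[LHS]/(lebesgue_measure _).
  by congr lebesgue_measure; apply/setIidl.
apply: ge0_subset_integral => //; first exact: measurable_funTS.
by move=> x /=; rewrite !in_itv/= => /andP[-> /ltW].
Qed.

End integral_dsqrt.

(** * The maximal inequality *)

Lemma measurable_superlevel {R : realType} (g : R -> R) (c : R) :
  measurable_fun [set: R] g -> measurable [set t | c < g t].
Proof.
move=> mg; rewrite (_ : [set t | _] = setT `&` g @^-1` `]c, +oo[).
  by apply: mg => //; exact: measurable_itv.
by apply/seteqP; split => t; rewrite /= in_itv/= andbT => // -[].
Qed.

Section maximal_inequality.
Context {R : realType}.
Variables (b l : R) (g : R -> R).
Hypotheses (l0 : 0 < l) (mg : measurable_fun [set: R] g).
Hypotheses (g0 : forall t, 0 <= g t) (gfrac : forall t, g (frac t) = g t).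

(* The maximum over $n \le N$ of $\sum_{j < n} (g (t + j b) - l)$. *)
Let M N : R -> R := iter N (fun m t => Num.max 0 (g t - l + m (t + b))) (fun=> 0).

Let M_ge0 N t : 0 <= M N t.
Proof. by case: N => [|N] //=; rewrite le_max lexx. Qed.

Let M_frac N t : M N (frac t) = M N t.
Proof.
elim: N t => [//|N IH] t /=; rewrite gfrac.
by rewrite -[M N (frac t + b)]IH fracDl IH.
Qed.

Let M_leS N t : M N t <= M N.+1 t.
Proof.
elim: N t => [|N IH] t; first exact: M_ge0.
by rewrite /= ge_max !le_max lexx/= lerD2l IH orbT.
Qed.

Let measurable_M N : measurable_fun [set: R] (M N).
Proof.
elim: N => [|N IH]; first exact: measurable_cst.
apply: measurable_maxr; first exact: measurable_cst.
apply: measurable_funD; first by apply: measurable_funB => //; exact: measurable_cst.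
by apply: (measurableT_comp IH); exact: measurable_funD.
Qed.

Let sum_le_M N n t : (n <= N)%N -> \sum_(j < n) g (t + b *+ j) - l * n%:R <= M N t.
Proof.
elim: N n t => [|N IH] [|n] t // nN; rewrite ?big_ord0 ?mulr0 ?subr0 ?M_ge0//.
rewrite big_ord_recl mulr0n addr0 -(natr1 n) /= le_max; apply/orP; right.
have := IH n (t + b) nN.
have -> : \sum_(j < n) g (t + b + b *+ j) = \sum_(j < n) g (t + b *+ lift ord0 j).
  by apply: eq_bigr => j _; rewrite mulrS addrA.
by rewrite mulrDr mulr1; lra.
Qed.

Let A N := [set t | 0 < M N t].

Let A_leS N : A N `<=` A N.+1.
Proof. by move=> t At; apply: (@lt_le_trans _ _ (M N t)) => //; exact: M_leS. Qed.

Let mA N : measurable (A N).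
Proof. exact: measurable_superlevel. Qed.

Local Notation mu := (@leb01 R).

Let mEM N : measurable_fun [set: R] (EFin \o M N).
Proof. exact/measurable_EFinP. Qed.

(* Garsia's inequality: as M N <= M N.+1, the maxima cancel after integration. *)
Let M_step N t : M N.+1 t + l * \1_(A N.+1) t <= g t + M N (t + b).
Proof.
have [|nA] := boolP (t \in A N.+1).
  rewrite inE /A /= indicE => tA; rewrite mem_set//= mulr1.
  by rewrite lt_max ltxx/= in tA; rewrite max_r ?(ltW tA)//; lra.
rewrite indicE (negbTE nA) mulr0 addr0.
move: nA; rewrite notin_setE /A/= => /negP; rewrite -leNgt => MN0.
by apply: le_trans MN0 _; rewrite addr_ge0.
Qed.

Let integral_rotM N : (\int[mu]_t (M N (t + b))%:E = \int[mu]_t (M N t)%:E)%E.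
Proof.
rewrite -(@integral_rot _ b (EFin \o M N))//; last by move=> t; rewrite lee_fin.
by apply: eq_integral => t _ /=; rewrite M_frac.
Qed.

Let EM_ge0 N t : (0 <= (M N t)%:E)%E. Proof. by rewrite lee_fin. Qed.

Hypothesis intg : (\int[mu]_t (g t)%:E <= 1)%E.

Let integral_M_step N : (\int[mu]_t (M N.+1 t)%:E + l%:E * mu (A N.+1) <=
  1 + \int[mu]_t (M N t)%:E)%E.
Proof.
have mAl : measurable_fun [set: R] (EFin \o \1_(A N.+1) : R -> \bar R).
  by apply/measurable_EFinP; exact: measurable_indic.
have mMb : measurable_fun [set: R] (fun t => (M N (t + b))%:E).
  apply/measurable_EFinP; apply: (measurableT_comp (measurable_M N)).
  exact: measurable_funD.
have EA : (l%:E * mu (A N.+1) = \int[mu]_t (l * \1_(A N.+1) t)%:E)%E.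
  rewrite -[in LHS](setIT (A N.+1)) -(integral_indic mu)//; last exact: mA.
  by rewrite -ge0_integralZl// lee_fin ltW.
have mlA : measurable_fun [set: R] (fun t => (l * \1_(A N.+1) t)%:E).
  apply/measurable_EFinP; apply: measurable_funM; first exact: measurable_cst.
  exact: measurable_indic.
have lA0 t : (0 <= (l * \1_(A N.+1) t)%:E)%E by rewrite lee_fin mulr_ge0// ltW.
have mEg : measurable_fun [set: R] (EFin \o g) by exact/measurable_EFinP.
rewrite EA -ge0_integralD//; last exact: (mEM N.+1).
apply: (@le_trans _ _ (\int[mu]_t ((g t)%:E + (M N (t + b))%:E))%E).
  have m1 := emeasurable_funD (mEM N.+1) mlA.
  have m2 := emeasurable_funD mEg mMb.
  apply: ge0_le_integral => //.
  - by move=> t _; rewrite adde_ge0.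
  - by move=> t _; rewrite -!EFinD lee_fin; exact: M_step.
rewrite ge0_integralD//; last by move=> t _; rewrite lee_fin.
by rewrite integral_rotM leeD2r.
Qed.

(** Finiteness, by induction from [integral_M_step], is what allows the integrals to be cancelled in
    [mu_A]. *)
Let integral_M_fin N : (\int[mu]_t (M N t)%:E)%E \is a fin_num.
Proof.
have ge0 n : (0 <= \int[mu]_t (M n t)%:E)%E by apply: integral_ge0.
rewrite ge0_fin_numE//; elim: N => [|N IH]; first by rewrite integral0 ltry.
apply: (@le_lt_trans _ _ (1 + \int[mu]_t (M N t)%:E)%E).
  apply: le_trans (integral_M_step N); rewrite leeDl// mule_ge0//.
  by rewrite lee_fin ltW.
by rewrite lte_add_pinfty// ltry.
Qed.

(** In [integral_M_step] the integral of [M N] is at most that of [M N.+1]; cancelling the latter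
    leaves l mu(A) <= 1 for [A N.+1], which contains [A N]. *)
Let mu_A N : (mu (A N) <= (l^-1)%:E)%E.
Proof.
apply: (@le_trans _ _ (mu (A N.+1))).
  by apply: le_measure; rewrite ?inE; [exact: mA|exact: mA|exact: A_leS].
rewrite -(@lee_pmul2l _ l%:E)// ?lte_fin// -EFinM mulfV ?gt_eqF//.
rewrite -(@leeD2lE _ (\int[mu]_t (M N.+1 t)%:E))//.
apply: le_trans (integral_M_step N) _; rewrite addeC leeD2r//.
apply: ge0_le_integral; [by []|by []|exact: (mEM N)|exact: (mEM N.+1)|].
by move=> t _; rewrite lee_fin; exact: M_leS.
Qed.

(** The exceptional set is the increasing union of the [A N], so it inherits their bound by
    continuity from below. Outside it all the maxima [M N] are 0, which is the bound on the sums. *)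
Lemma maximal_inequality : exists2 B : set R, measurable B /\ (mu B <= (l^-1)%:E)%E &
  forall t, ~ B t -> forall n, \sum_(j < n) g (t + b *+ j) <= l * n%:R.
Proof.
have mB : measurable (\bigcup_N A N) by exact: bigcupT_measurable.
have Acvg : (mu \o A) x @[x --> \oo] --> mu (\bigcup_N A N).
  apply: nondecreasing_cvg_mu => //; apply/nondecreasing_seqP => N.
  by apply/subsetPset => t /= At; exact: lt_le_trans At (M_leS N t).
exists (\bigcup_N A N).
  split=> //; rewrite -(cvg_lim _ Acvg)//; apply: lime_le.
    by apply/cvg_ex; eexists; exact: Acvg.
  by apply: nearW => N; exact: mu_A.
move=> t Bt n; rewrite -subr_le0; apply: le_trans (sum_le_M t (leqnn n)) _.
by rewrite leNgt; apply/negP => At; apply: Bt; exists n.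
Qed.

End maximal_inequality.

(** * Points with a tempered orbit, up to small measure *)

Section tempered.
Context {R : realType}.
Local Notation mu := (@leb01 R).

Lemma tempered_measure (a b l : R) : 0 < l ->
  exists2 B : set R, measurable B /\ (mu B <= (l^-1)%:E)%E &
    forall t, ~ B t -> tempered a b l t.
Proof.
move=> l0; pose g t := dsqrt (frac (t + a)).
have mg : measurable_fun [set: R] g.
  exact: (measurableT_comp measurable_dsqrt (measurable_fracD a)).
have g0 t : 0 <= g t by exact: dsqrt_ge0.
have gfrac t : g (frac t) = g t by rewrite /g fracDl.
have [B [mB Bl] Bg] := maximal_inequality b l0 mg g0 gfrac (leb01_integral_dsqrt a).
(* The orbit is at 0 at time n only on a null set, by rotation invariance; the union over n is still
   null. *)
pose Z n := (fun t => frac (t + (a + b *+ n))) @^-1` [set 0].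
have mZ n : measurable (Z n) by rewrite -[Z n]setTI; exact: measurable_fracD.
have Z0 n : mu (Z n) = 0%E.
  rewrite leb01_rot//; apply/eqP; rewrite eq_le measure_ge0 andbT.
  rewrite -(@lebesgue_measure_set1 R 0); apply: le_measure; rewrite ?inE//.
  - by apply: measurableI.
have ZU : mu (\bigcup_n Z n) = 0%E.
  apply: measure_negligible; first exact: bigcupT_measurable.
  by apply: negligible_bigcup => n; apply/negligibleP; [exact: mZ|exact: Z0].
exists (B `|` \bigcup_n Z n).
  have mU : measurable (\bigcup_n Z n) by exact: bigcupT_measurable.
  split; first exact: measurableU.
  have /le_trans := @measureU2 _ _ _ mu B (\bigcup_n Z n) mB mU.
  by apply; rewrite [X in (_ + X)%E]ZU adde0.
move=> t /not_orP[Bt Zt] n; split.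
  rewrite lt_neqAle frac_ge0 andbT eq_sym -addrA.
  by apply/eqP => tn; apply: Zt; exists n.
apply: le_trans (Bg t Bt n); rewrite le_eqVlt; apply/orP; left; apply/eqP.
by apply: eq_bigr => j _; rewrite /g addrAC.
Qed.

End tempered.

(** * Series of bounded functions *)

Section complex_sums.
Context {R : realType}.
Implicit Types (u v : nat -> R[i]) (z : R[i]) (B q : R).

Lemma normc_Re z : `|complex.Re z| <= normc z.
Proof. by case: z => x y /=; rewrite -sqrtr_sqr ler_wsqrtr// lerDl sqr_ge0. Qed.

Lemma normc_Im z : `|complex.Im z| <= normc z.
Proof. by case: z => x y /=; rewrite -sqrtr_sqr ler_wsqrtr// lerDr sqr_ge0. Qed.

Lemma normc_le_ReIm z : normc z <= `|complex.Re z| + `|complex.Im z|.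
Proof.
case: z => x y; have -> : x +i* y = x%:C + (0 +i* y) by rewrite /= /real_complex_def; simpc.
apply: le_trans (normcD _ _) _.
by rewrite /= !expr0n /= !addr0 !add0r !sqrtr_sqr.
Qed.

Lemma geometric_bound_cvg (u : nat -> R) B q : 0 <= q < 1 ->
  (forall n, `|u n| <= B * q ^+ n) -> cvgn (series u).
Proof.
move=> /andP[q0 q1] uB; apply: normed_cvg.
apply: (@series_le_cvg _ _ (geometric B q)) => //.
- by move=> n; exact: normr_ge0.
- by move=> n; exact: le_trans (normr_ge0 _) (uB n).
- by apply: is_cvg_geometric_series; rewrite ger0_norm.
Qed.

Lemma geometric_bound_lim (u : nat -> R) B q : 0 <= q < 1 ->
  (forall n, `|u n| <= B * q ^+ n) -> `|limn (series u)| <= B / (1 - q).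
Proof.
move=> /andP[q0 q1] uB; have qn : `|q| < 1 by rewrite ger0_norm.
have cN : cvgn [normed series u].
  apply: (@series_le_cvg _ _ (geometric B q)) => //.
  - by move=> n; exact: normr_ge0.
  - by move=> n; exact: le_trans (normr_ge0 _) (uB n).
  - exact: is_cvg_geometric_series.
apply: le_trans (lim_series_norm cN) _.
rewrite -(cvg_lim _ (@cvg_geometric_series _ B _ qn))//.
apply: ler_lim => //; first exact: is_cvg_geometric_series.
by apply: nearW => n; apply: ler_sum => k _; exact: uB.
Qed.

(** Summing real and imaginary parts separately reduces everything to real series and fits the
    definition of [cmeasurable]. *)
Definition csum u : R[i] :=
  limn (series (fun n => complex.Re (u n))) +i*
  limn (series (fun n => complex.Im (u n))).

Definition gbounded q u := exists B, forall n, normc (u n) <= B * q ^+ n.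

Section geometric.
Variable q : R.
Hypothesis q01 : 0 <= q < 1.

Let csum_cvg u : gbounded q u ->
  cvgn (series (fun n => complex.Re (u n))) /\
  cvgn (series (fun n => complex.Im (u n))).
Proof.
by move=> [B uB]; split; apply: (@geometric_bound_cvg _ B) q01 _ => n;
  apply: le_trans (uB n); [exact: normc_Re|exact: normc_Im].
Qed.

Lemma csum_linear a u v : gbounded q u -> gbounded q v ->
  csum (fun n => u n + a * v n) = csum u + a * csum v.
Proof.
move=> /csum_cvg[ur ui] /csum_cvg[vr vi]; case: a => x y; rewrite /csum.
set ur' := fun n => complex.Re (u n) in ur *.
set ui' := fun n => complex.Im (u n) in ui *.
set vr' := fun n => complex.Re (v n) in vr *.
set vi' := fun n => complex.Im (v n) in vi *.
have -> : (fun n => complex.Re (u n + (x +i* y) * v n)) = ur' + (x *: vr' + - y *: vi').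
  apply/funext => n; rewrite /ur' /vr' /vi' !fctE.
  by case: (u n) (v n) => [? ?] [? ?] /=; rewrite -[- y *: _]/(- y * _) mulNr.
have -> : (fun n => complex.Im (u n + (x +i* y) * v n)) = ui' + (x *: vi' + y *: vr').
  apply/funext => n; rewrite /ui' /vr' /vi' !fctE.
  by case: (u n) (v n) => [? ?] [? ?].
have cZ (k : R) (f : nat -> R) : cvgn (series f) -> cvgn (series (k *: f)) by exact: is_cvg_seriesZ.
have cD (f g : nat -> R) : cvgn (series f) -> cvgn (series g) -> cvgn (series (f + g)).
  exact: is_cvg_seriesD.
rewrite (lim_seriesD ur (cD _ _ (cZ x _ vr) (cZ (- y) _ vi))).
rewrite (lim_seriesD ui (cD _ _ (cZ x _ vi) (cZ y _ vr))).
rewrite (lim_seriesD (cZ x _ vr) (cZ (- y) _ vi)).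
rewrite (lim_seriesD (cZ x _ vi) (cZ y _ vr)) !lim_seriesZ//.
move: (limn (series ur')) (limn (series ui')) (limn (series vr')) (limn (series vi')) => A B C D.
by apply/eqP; rewrite eq_complex/= -mulNr !eqxx.
Qed.

Lemma csum_le u B : (forall n, normc (u n) <= B * q ^+ n) ->
  normc (csum u) <= 2 * (B / (1 - q)).
Proof.
move=> uB; apply: le_trans (normc_le_ReIm _) _; rewrite mulr2n mulrDl !mul1r.
by apply: lerD; apply: geometric_bound_lim => // n; apply: le_trans (uB n);
  [exact: normc_Re|exact: normc_Im].
Qed.

Lemma csumS u : gbounded q u -> csum u = u 0%N + csum (fun n => u n.+1).
Proof.
move=> /csum_cvg[cr ci].
have E (f : nat -> R) : cvgn (series f) ->
    limn (series f) = f 0%N + limn (series (fun n => f n.+1)).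
  move=> cf; apply/eqP; rewrite addrC -subr_eq; apply/eqP/esym/cvg_lim => //.
  have -> : series (fun n => f n.+1) = (fun n => series f n.+1 - f 0%N).
    by apply/funext => n; rewrite !seriesEnat /= big_nat_recl// addrAC subrr add0r.
  by apply: cvgB; [rewrite cvg_shiftS|exact: cvg_cst].
by rewrite /csum (E _ cr) (E _ ci); case: (u 0%N).
Qed.

Lemma cmeasurable_csum (f : nat -> R -> R[i]) :
  (forall n, cmeasurable (f n : measurableTypeR R -> R[i])) ->
  (forall t, gbounded q (f ^~ t)) ->
  cmeasurable ((fun t => csum (f ^~ t)) : measurableTypeR R -> R[i]).
Proof.
move=> mf bf; split.
- apply: (@measurable_fun_cvg _ _ _ _ (fun n t => series (fun k => complex.Re (f k t)) n)).
    by move=> n; apply: measurable_sum => k; have [] := mf k.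
  by move=> t _; have [] := csum_cvg (bf t).
- apply: (@measurable_fun_cvg _ _ _ _ (fun n t => series (fun k => complex.Im (f k t)) n)).
    by move=> n; apply: measurable_sum => k; have [] := mf k.
  by move=> t _; have [] := csum_cvg (bf t).
Qed.

End geometric.

Lemma gboundedD q u v a : gbounded q u -> gbounded q v ->
  gbounded q (fun n => u n + a * v n).
Proof.
move=> [B uB] [C vC]; exists (B + normc a * C) => n.
apply: le_trans (normcD _ _) _; rewrite normcM mulrDl -mulrA.
by apply: lerD => //; apply: ler_wpM2l => //; exact: normc_ge0.
Qed.

End complex_sums.

Lemma normcX {R : realType} (z : R[i]) n : normc (z ^+ n) = normc z ^+ n.
Proof. by elim: n => [|n IH]; rewrite ?expr0 ?normc1// !exprS normcM IH. Qed.

(** * Complex differentiability of power series *)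

Section power_series.
Context {R : realType}.
Implicit Types (z h : R[i]) (s r : R).

(** The left side is one term of the binomial expansion of (a + s)^n. *)
Lemma exprS_bound (a s r : R) n : 0 <= a -> 0 <= s -> a + s <= r ->
  n%:R * a ^+ n.-1 * s <= r ^+ n.
Proof.
move=> a0 s0 asr; have r0 : 0 <= r by apply: le_trans asr; exact: addr_ge0.
elim: n => [|n IH]; first by rewrite !mul0r expr0.
have IH' : n%:R * a ^+ n * s <= a * r ^+ n.
  case: n IH => [|n] IH; first by rewrite !mul0r expr0 mulr1.
  by rewrite exprS mulrCA -!mulrA ler_wpM2l//= mulrA.
rewrite /= -natr1 mulrDl mul1r mulrDl exprS.
have an : a ^+ n <= r ^+ n by rewrite lerXn2r ?nnegrE//; lra.
have : a ^+ n * s <= r ^+ n * s by rewrite ler_wpM2r.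
have : (a + s) * r ^+ n <= r * r ^+ n by rewrite ler_wpM2r// exprn_ge0.
lra.
Qed.

(** A Taylor remainder with a geometric bound in n, fit for termwise use in a series. The remainders
    satisfy e_(n+1) = (z + h) e_n + n z^(n-1) h^2. Of the margin [2 * s], one [s] covers [h] and the
    other absorbs the last term. *)
Lemma expr_second_order z h s r n : 0 < s -> normc z + 2 * s <= r -> normc h <= s ->
  normc ((z + h) ^+ n - z ^+ n - n%:R * z ^+ n.-1 * h) <=
  (normc h / s) ^+ 2 * r ^+ n.
Proof.
move=> s0 zr hs; have z0 := normc_ge0 z; have h0 := normc_ge0 h.
have r0 : 0 <= r by lra.
have normc_nat m : normc (m%:R : R[i]) = m%:R :> R.
  by rewrite normcMn normc1.
elim: n => [|n IH].
  by rewrite !expr0 subrr mul0r mul0r subr0 normc0 mulr1 exprn_ge0// divr_ge0// ltW.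
set e := (X in normc X) in IH.
have -> : (z + h) ^+ n.+1 - z ^+ n.+1 - n.+1%:R * z ^+ n.+1.-1 * h =
    (z + h) * e + n%:R * z ^+ n.-1 * h ^+ 2.
  rewrite /e; case: n {IH e} => [|n] /=; rewrite -?natr1 ?exprS; ring.
apply: le_trans (normcD _ _) _; rewrite !normcM !normcX normc_nat.
have b : n%:R * normc z ^+ n.-1 * s <= r ^+ n by apply: exprS_bound => //; lra.
have zh : normc (z + h) <= r - s by apply: le_trans (normcD _ _) _; lra.
have h1 : normc (z + h) * normc e <= (r - s) * ((normc h / s) ^+ 2 * r ^+ n).
  by apply: ler_pM => //; exact: normc_ge0.
have h2 : n%:R * normc z ^+ n.-1 * normc h ^+ 2 <= s * ((normc h / s) ^+ 2 * r ^+ n).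
  rewrite (_ : s * _ = normc h ^+ 2 / s * r ^+ n); last by field; rewrite gt_eqF.
  rewrite (_ : _ * normc h ^+ 2 = normc h ^+ 2 / s * (n%:R * normc z ^+ n.-1 * s)).
    by apply: ler_wpM2l => //; rewrite divr_ge0 ?exprn_ge0// ltW.
  by field; rewrite gt_eqF.
by rewrite -expr2 [r ^+ n.+1]exprS; lra.
Qed.

(** [S] stands for summation against fixed vectors: a bounded linear map on the sequences dominated
    by r^n. Differentiating w -> S (w^n) then uses only linearity and the bound, and no convergence
    of partial sums in [X]. *)
Variables (X : normedModType R[i]) (S : (nat -> R[i]) -> X) (r K : R).
Hypothesis S_linear : forall (a : R[i]) u v, gbounded r u -> gbounded r v ->
  S (fun n => u n + a * v n) = S u + a *: S v.
Hypothesis S_bound : forall u B, (forall n, normc (u n) <= B * r ^+ n) ->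
  `|S u| <= (K * B)%:C.

Lemma derivable_quadratic (G : R[i] -> X) z (D : X) (C s : R) : 0 < s ->
  (forall h, normc h <= s -> `|G (z + h) - G z - h *: D| <= (C * normc h ^+ 2)%:C) ->
  derivable G z 1.
Proof.
move=> s0 GD; apply/cvg_ex; exists D.
apply/cvgrPdist_le => e e0.
have C0 : 0 < `|C| + 1 by rewrite ltr_wpDl.
(* A positive element of [R[i]] is real, so the estimates can be made in [R]. *)
have eE : e = (complex.Re e)%:C by rewrite RRe_real// realE ltW.
have e'0 : 0 < complex.Re e by rewrite -ltcR -eE.
have d0 : 0 < Num.min s (complex.Re e / (`|C| + 1)) by rewrite lt_min s0 divr_gt0.
exists (Num.min s (complex.Re e / (`|C| + 1)))%:C; first by rewrite /= ltcR.
move=> h /=; rewrite sub0r normrN normrc ltcR lt_min => /andP[hs he] h0.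
have h0' : 0 < `|h| by rewrite normr_gt0.
rewrite [h *: 1]mulr1 [h + z]addrC.
rewrite -(ler_pM2l h0') -normrZ scalerBr scalerA mulfV// scale1r distrC.
apply: le_trans (GD h (ltW hs)) _.
rewrite eE normrc -rmorphM lecR expr2 mulrA mulrC ler_wpM2l ?normc_ge0//.
apply: (@le_trans _ _ ((`|C| + 1) * normc h)).
  by rewrite ler_wpM2r ?normc_ge0//; have := ler_norm C; lra.
by rewrite mulrC -ler_pdivlMr// ltW.
Qed.

Lemma derivable_power_series z : normc z < r ->
  derivable (fun w : R[i] => S (fun n => w ^+ n)) z 1.
Proof.
move=> zr; pose s := (r - normc z) / 2; have s0 : 0 < s by rewrite divr_gt0// subr_gt0.
have zsr : normc z + 2 * s <= r by rewrite /s; lra.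
have z0 := normc_ge0 z.
have bX w : normc w <= r -> gbounded r (fun n => w ^+ n).
  move=> wr; exists 1 => n; rewrite normcX mul1r lerXn2r ?nnegrE ?normc_ge0//.
  by apply: le_trans wr; exact: normc_ge0.
have bd : gbounded r (fun n => n%:R * z ^+ n.-1).
  exists s^-1 => n; rewrite normcM normcMn normc1 normcX [s^-1 * _]mulrC ler_pdivlMr//.
  by apply: exprS_bound => //; lra.
pose D := S (fun n => n%:R * z ^+ n.-1).
apply: (@derivable_quadratic _ z D (K / s ^+ 2) s) => // h hs.
pose e n := (z + h) ^+ n - z ^+ n - n%:R * z ^+ n.-1 * h.
have eb n : normc (e n) <= (normc h / s) ^+ 2 * r ^+ n by exact: expr_second_order.
have be : gbounded r e by eexists; exact: eb.
(* Linearity splits off the first-order part [h *: D]; what remains is [S e], quadratic in [h] by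
   [S_bound]. *)
have -> : S (fun n => (z + h) ^+ n) = S e + 1 *: (S (fun n => z ^+ n) + h *: D).
  rewrite -S_linear//; last by apply: bX; lra.
  rewrite -S_linear//; last by apply: gboundedD => //; apply: bX; lra.
  by congr S; apply/funext => n; rewrite /e; ring.
rewrite scale1r -addrA -opprD addrK; apply: le_trans (S_bound eb) _.
rewrite lecR le_eqVlt; apply/orP; left; apply/eqP.
by field; rewrite gt_eqF.
Qed.

End power_series.

(** * Bounded functions as elements of L^p *)

Section bounded_functions.
Context {R : realType}.
Variables (p : R) (p1 : 1 <= p).
Implicit Types (f g : R -> R[i]) (a b M : R).

Local Notation mu := (@leb01 R).
Local Notation pi := (\pi_(cLspace mu p1)).
Local Notation cmeas f := (cmeasurable (f : measurableTypeR R -> R[i])).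

Lemma leb01_setT : mu setT = 1%E.
Proof.
rewrite -[LHS]/(lebesgue_measure _) setTI lebesgue_measure_itv/= lte_fin ltr01.
by rewrite oppr0 adde0.
Qed.

Definition bounded_cmeas f := cmeas f /\ exists M, forall t, normc (f t) <= M.

Lemma cLnorm_le_bound f M : cmeas f -> (forall t, normc (f t) <= M) ->
  (cLnorm mu p f <= M%:E)%E.
Proof.
move=> mf fM; have M0 : 0 <= M by apply: le_trans (fM 0); exact: normc_ge0.
have p0 : 0 < p by exact: lt_le_trans p1.
have normM : normc M%:C = M.
  by rewrite /= expr0n addr0 sqrtr_sqr ger0_norm.
apply: (@le_trans _ _ (cLnorm mu p (fun=> M%:C))).
  apply: (le_cLnorm p1) => //.
  by apply: nearW => t; rewrite normM.
rewrite cLnormE; under eq_integral do rewrite normM.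
by rewrite integral_cst// leb01_setT mule1 poweR_EFin -powRrM mulfV ?gt_eqF// powRr1.
Qed.

Lemma bounded_cLfun f : bounded_cmeas f -> f \in cLfun mu p1.
Proof.
move=> [mf [M fM]]; apply: mem_set; split => //.
by apply: le_lt_trans (cLnorm_le_bound mf fM) _; rewrite ltry.
Qed.

(** Total, with default value 0 outside L^p, so that it composes with functions of a complex
    parameter. On bounded measurable functions it is the class of [f], by [bounded_insubdK]. *)
Definition toLp f : Lp01 p1 := pi (insubd (0 : cLfunType mu p1) f).

Lemma bounded_insubdK f : bounded_cmeas f ->
  insubd (0 : cLfunType mu p1) f = f :> (R -> R[i]).
Proof. by move=> bf; rewrite insubdK//; exact: bounded_cLfun. Qed.

Lemma toLp_linear (c : R[i]) f g : bounded_cmeas f -> bounded_cmeas g ->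
  bounded_cmeas (fun t => f t + c * g t) ->
  toLp (fun t => f t + c * g t) = toLp f + c *: toLp g.
Proof.
move=> bf bg bfg; rewrite /toLp -[c *: _]/(cLscale _ _) -pi_cLspaceZ -pi_cLspaceD.
apply/cLspace_eqP/nearW => t.
by rewrite cLfunDE cLfunZE !bounded_insubdK.
Qed.

Lemma norm_toLp f M : cmeas f -> (forall t, normc (f t) <= M) ->
  `|toLp f| <= M%:C.
Proof.
move=> mf fM; rewrite -[`|_|]/(cLspace_norm _) cLspace_norm_pi lecR.
have bf : bounded_cmeas f by split => //; exists M.
rewrite bounded_insubdK// -lee_fin fineK; first exact: cLnorm_le_bound.
by rewrite -(bounded_insubdK bf) cLnorm_fin.
Qed.

Definition wrot a b f t := (frac (t + a))%:C * f (frac (t + b)).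

Lemma cmeasurable_rot b f : cmeas f -> cmeas (fun t => f (frac (t + b))).
Proof.
move=> [fr fi]; split.
- exact: (measurableT_comp fr (measurable_fracD b)).
- exact: (measurableT_comp fi (measurable_fracD b)).
Qed.

Lemma normc_frac (t : R) : normc (frac t)%:C = frac t.
Proof. by rewrite /= expr0n addr0 sqrtr_sqr ger0_norm// frac_ge0. Qed.

Lemma cmeasurable_wrot a b f : cmeas f -> cmeas (wrot a b f).
Proof.
move=> mf; apply: cmeasurableM; last exact: cmeasurable_rot.
by apply: cmeasurable_real; exact: measurable_fracD.
Qed.

Lemma bounded_wrot a b f : bounded_cmeas f -> bounded_cmeas (wrot a b f).
Proof.
move=> [mf [M fM]]; split; first exact: cmeasurable_wrot.
exists M => t; rewrite normcM normc_frac; apply: le_trans (fM (frac (t + b))).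
by rewrite ler_piMl ?normc_ge0// ltW// frac_lt1.
Qed.

Lemma bishop_toLp alpha f : bounded_cmeas f ->
  bishop p1 alpha (toLp f) = toLp (wrot 0 alpha f).
Proof.
move=> bf; rewrite /toLp bishop_pi; apply/cLspace_eqP; apply: leb01_ae => t t01.
rewrite /= /bishop_fun !bounded_insubdK//; last exact: bounded_wrot.
by rewrite /wrot addr0 (frac_id t01).
Qed.

Lemma bishop_adj_toLp alpha f : bounded_cmeas f ->
  bishop_adj p1 alpha (toLp f) = toLp (wrot (- alpha) (- alpha) f).
Proof.
move=> bf; rewrite /toLp bishop_adj_pi; apply/cLspace_eqP; apply: nearW => t.
by rewrite /= /bishop_adj_fun !bounded_insubdK//; exact: bounded_wrot.
Qed.

Section function_series.
Variables (A k r : R) (x_ : nat -> R -> R[i]).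
Hypotheses (k0 : 0 <= k) (r0 : 0 <= r) (kr1 : k * r < 1).
Hypotheses (mx : forall n, cmeas (x_ n)).
Hypothesis xA : forall n t, normc (x_ n t) <= A * k ^+ n.

Let kr01 : 0 <= k * r < 1. Proof. by rewrite mulr_ge0. Qed.

Definition fsum (c : nat -> R[i]) t := csum (fun n => c n * x_ n t).

Let coef_bound c B t n : (forall n, normc (c n) <= B * r ^+ n) ->
  normc (c n * x_ n t) <= B * A * (k * r) ^+ n.
Proof.
move=> cB; rewrite normcM exprMn [k ^+ n * _]mulrC mulrACA.
by apply: ler_pM => //; exact: normc_ge0.
Qed.

Lemma gbounded_fsum c t : gbounded r c -> gbounded (k * r) (fun n => c n * x_ n t).
Proof. by move=> [B cB]; exists (B * A) => n; exact: coef_bound. Qed.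

Lemma fsum_bound c B t : (forall n, normc (c n) <= B * r ^+ n) ->
  normc (fsum c t) <= 2 * A / (1 - k * r) * B.
Proof.
move=> cB; apply: (@le_trans _ _ (2 * (B * A / (1 - k * r)))).
  by apply: csum_le => // n; exact: coef_bound.
by rewrite le_eqVlt; apply/orP; left; apply/eqP; ring.
Qed.

Lemma cmeasurable_fsum c : gbounded r c -> cmeas (fsum c).
Proof.
move=> bc; apply: (cmeasurable_csum kr01) => [n|t]; last exact: gbounded_fsum.
by apply: cmeasurableM => //; split; exact: measurable_cst.
Qed.

Lemma bounded_fsum c : gbounded r c -> bounded_cmeas (fsum c).
Proof.
move=> bc; split; first exact: cmeasurable_fsum.
by case: bc => B cB; eexists => t; exact: (fsum_bound t cB).
Qed.

Lemma fsum_linear (a : R[i]) c d : gbounded r c -> gbounded r d ->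
  fsum (fun n => c n + a * d n) = (fun t => fsum c t + a * fsum d t).
Proof.
move=> bc bd; apply/funext => t; rewrite /fsum.
rewrite -(csum_linear kr01)//; [|exact: gbounded_fsum..].
by congr csum; apply/funext => n; ring.
Qed.

(** The map from coefficients [c] to [toLp (fsum c)] is linear and bounded as
    [derivable_power_series] asks; the constant comes from [fsum_bound]. *)
Lemma derivable_fsum z : normc z < r ->
  derivable (fun w : R[i] => toLp (fsum (fun n => w ^+ n))) z 1.
Proof.
apply: (@derivable_power_series _ _ (fun c => toLp (fsum c)) r (2 * A / (1 - k * r))).
- move=> a c d bc bd; rewrite fsum_linear// toLp_linear//; [exact: bounded_fsum..|].
  by rewrite -fsum_linear//; apply: bounded_fsum; exact: gboundedD.
- move=> c B cB; apply: norm_toLp; last by move=> t; exact: fsum_bound.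
  by apply: cmeasurable_fsum; exists B.
Qed.

End function_series.
End bounded_functions.

(** * Local resolvents *)

Section geometric_sequences.
Context {R : realType}.
Implicit Types (q : R) (u : nat -> R[i]).

Lemma gboundedS q u : gbounded q u -> gbounded q (fun n => u n.+1).
Proof. by move=> [B uB]; exists (B * q) => n; rewrite -mulrA -exprS. Qed.

Lemma csumZ q (a : R[i]) u : 0 <= q < 1 -> gbounded q u ->
  csum (fun n => a * u n) = a * csum u.
Proof.
move=> q01 bu; have b0 : gbounded q (fun=> 0 : R[i]).
  by exists 0 => n; rewrite normc0 mul0r.
have c0 : csum (fun=> 0 : R[i]) = 0.
  have := csum_linear q01 1 b0 b0; rewrite !mul1r addr0 => /eqP.
  by rewrite -[X in X == _]addr0 (inj_eq (addrI _)) eq_sym => /eqP.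
rewrite -[RHS]add0r -[in RHS]c0 -(csum_linear q01)//.
by congr csum; apply/funext => n; rewrite add0r.
Qed.

Lemma gbounded_expr (z : R[i]) q : normc z <= q -> gbounded q (fun n => z ^+ n).
Proof.
move=> zq; have z0 := normc_ge0 z; have q0 : 0 <= q by exact: le_trans zq.
exists 1 => n; rewrite mul1r; elim: n => [|n IH]; first by rewrite !expr0 normc1.
by rewrite !exprS normcM ler_pM// normc_ge0.
Qed.

End geometric_sequences.

Section local_resolvents.
Context {R : realType}.
Variables (p : R) (p1 : 1 <= p) (a b : R).
Variable T : {linear Lp01 p1 -> Lp01 p1}.
Hypothesis b_irr : irrational b.
Hypothesis T_toLp : forall f, bounded_cmeas f -> T (toLp p1 f) = toLp p1 (wrot a b f).

Local Notation cmeas f := (cmeasurable (f : measurableTypeR R -> R[i])).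
Local Notation toLp := (toLp p1).

Lemma local_resolvent_eq x F (z : R[i]) : bounded_cmeas x -> bounded_cmeas F ->
  (forall t, wrot a b F t = x t + z * F t) ->
  T (toLp F) - z *: toLp F = toLp x.
Proof.
move=> bx bF FE; have wE : wrot a b F = (fun t => x t + z * F t) by exact/funext.
rewrite T_toLp// wE toLp_linear// ?addrK// -wE; exact: bounded_wrot.
Qed.

Lemma wrot_fsum (x_ : nat -> R -> R[i]) q c t : 0 <= q < 1 ->
  gbounded q (fun n => c n * x_ n (frac (t + b))) ->
  wrot a b (fsum x_ c) t = csum (fun n => c n * wrot a b (x_ n) t).
Proof.
move=> q01 bc; rewrite /wrot /fsum -(csumZ _ q01 bc).
by congr csum; apply/funext => n; rewrite mulrCA.
Qed.

Let e1 : R := expR (-1).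

Lemma cocycle_le_geometric r : e1 < r ->
  exists2 C, 0 < C & forall n t, cocycle a b n t <= C * r ^+ n.
Proof.
move=> er; have r0 : 0 < r by apply: lt_trans er; exact: expR_gt0.
(* For e = ln r + 1 the rate [expR (e - 1)] equals [r]. *)
have e0 : 0 < ln r + 1 by rewrite -ltrBlDr sub0r -(expRK (-1)) ltr_ln// posrE expR_gt0.
have [C C0 cC] := cocycle_le a b_irr e0; exists C => // n t.
by have := cC n t; rewrite addrK lnK.
Qed.

Lemma cocycle_ge_geometric l r : 0 < l -> 0 < r < e1 ->
  exists2 C, 0 < C &
    forall t, tempered a b l t -> forall n, C * r ^+ n <= cocycle a b n t.
Proof.
move=> l0 /andP[r0 re].
have e0 : 0 < - ln r - 1.
  by rewrite subr_gt0 ltrNr -(expRK (-1)) ltr_ln// posrE expR_gt0.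
have [C C0 cC] := cocycle_ge a b_irr l0 e0; exists C => // t tt n.
by have := cC t tt n; rewrite opprB addrC addKr opprK lnK.
Qed.

Variables (l : R) (x : R -> R[i]).
Hypotheses (l0 : 0 < l) (bx : bounded_cmeas x) (x_frac : forall t, x (frac t) = x t).
Hypothesis x_tempered : forall t, x t != 0 -> tempered a b l t.

(** S^-n x: solving S^n y = x at [v] = {t - n b} gives y(t) = x(v) / cocycle(v). For tempered [x] a
    zero denominator occurs only where x(v) = 0. *)
Definition backward n t : R[i] :=
  let v := frac (t - b *+ n) in (cocycle a b n v)^-1%:C * x v.

Lemma wrot_backward n : wrot a b (backward n.+1) = backward n.
Proof.
apply/funext => t; rewrite /wrot /backward.
have -> : frac (frac (t + b) - b *+ n.+1) = frac (t - b *+ n).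
  by rewrite fracDl mulrS opprD addrA addrK.
set v := frac (t - _); have [->|xv] := eqVneq (x v) 0; first by rewrite !mulr0.
have [tv _] := x_tempered xv n.
rewrite mulrA -rmorphM; congr (_%:C * _).
(* The last factor of the product of length n + 1 from [v] is the weight at [t], so the two
   cancel. *)
have vt : frac (v + a + b *+ n) = frac (t + a).
  by rewrite /v -[_ + a + _]addrA fracDl; congr frac; rewrite addrACA addNr addr0.
rewrite cocycleSr vt invfM mulrC -mulrA mulVf ?mulr1//.
by rewrite -vt gt_eqF.
Qed.

Lemma cmeasurable_backward n : cmeas (backward n).
Proof.
have mcocycle m : measurable_fun [set: R] (cocycle a b m).
  elim: m => [|m IH].
    by rewrite (_ : cocycle a b 0 = cst 1)//; apply/funext => t; rewrite /cocycle big_ord0.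
  rewrite (_ : cocycle a b m.+1 = (fun t => cocycle a b m t * frac (t + a + b *+ m))).
    apply: measurable_funM => //; apply: (measurableT_comp measurable_frac).
    by apply: measurable_funD => //; exact: measurable_funD.
  by apply/funext => t; rewrite cocycleSr.
apply: (@cmeasurable_rot _ (- (b *+ n)) (fun v => (cocycle a b n v)^-1%:C * x v)).
apply: cmeasurableM; last by case: bx.
apply: (@cmeasurable_real _ _ _ (fun v => (cocycle a b n v)^-1)).
rewrite (_ : (fun v => _) = (@powR R ^~ (-1)) \o cocycle a b n).
  by apply: measurableT_comp => //; exact: measurable_powR.
by apply/funext => v; rewrite /= powR_inv1// cocycle_ge0.
Qed.

Lemma backward_bound r : 0 < r < e1 ->
  exists A, forall n t, normc (backward n t) <= A * r^-1 ^+ n.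
Proof.
move=> r01; have [C C0 Cr] := cocycle_ge_geometric l0 r01.
have [_ [M xM]] := bx; have M0 : 0 <= M by apply: le_trans (xM 0); exact: normc_ge0.
case/andP: r01 => r0 _; exists (C^-1 * M) => n t; rewrite /backward; set v := frac _.
have [->|xv] := eqVneq (x v) 0.
  by rewrite mulr0 normc0 mulr_ge0// ?exprn_ge0 ?mulr_ge0// invr_ge0 ltW.
have cv : 0 < cocycle a b n v.
  by apply: lt_le_trans (Cr v (x_tempered xv) n); rewrite mulr_gt0// exprn_gt0.
rewrite normcM mulrAC; apply: ler_pM => //; first exact: normc_ge0.
- exact: normc_ge0.
- rewrite /= expr0n addr0 sqrtr_sqr ger0_norm ?invr_ge0 ?(ltW cv)// exprVn -invfM.
  by rewrite lef_pV2 ?posrE ?mulr_gt0 ?exprn_gt0// Cr//; exact: x_tempered.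
Qed.

Lemma open_nbhs_ballc (z : R[i]) (s : R) : 0 < s -> open_nbhs z (ball z s%:C).
Proof.
move=> s0; have s0' : 0 < s%:C :> R[i] by rewrite ltcR.
by split; [exact: ball_open|exact: ballxx].
Qed.

Lemma ballcP (z w : R[i]) (s : R) : ball z s%:C w -> normc (z - w) < s.
Proof. by rewrite -ball_normE /= normrc ltcR. Qed.

Lemma local_resolvent_inside (z0 : R[i]) : normc z0 < e1 ->
  local_resolvent T (toLp x) z0.
Proof.
move=> z0e; have z00 := normc_ge0 z0.
(* |z0| < s < r < e^-1: the backward iterates are O(r^-n), so the series converges geometrically for
   |z| < s, which holds on the ball of radius s - |z0| about z0. *)
pose r := (normc z0 + e1) / 2; pose s := (normc z0 + r) / 2.
have e0 : 0 < e1 by exact: expR_gt0.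
have r01 : 0 < r < e1 by apply/andP; rewrite /r; split; lra.
have /andP[r0 re] := r01.
have s0 : 0 <= s by rewrite /s; lra.
have sr : r^-1 * s < 1 by rewrite mulrC ltr_pdivrMr// mul1r /s; rewrite /r in re *; lra.
have z0s : normc z0 < s by rewrite /s; rewrite /r in re *; lra.
have r'0 : 0 <= r^-1 by rewrite invr_ge0 ltW.
have [A bA] := backward_bound r01.
pose x_ n := backward n.+1.
have xA n t : normc (x_ n t) <= A / r * r^-1 ^+ n by rewrite -mulrA -exprS; exact: bA.
have mx n : cmeas (x_ n) by exact: cmeasurable_backward.
have sr01 : 0 <= r^-1 * s < 1 by rewrite mulr_ge0.
exists (ball z0 (s - normc z0)%:C), (fun z : R[i] => toLp (fsum x_ (fun n => z ^+ n))).
have zs z : ball z0 (s - normc z0)%:C z -> normc z < s.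
  move=> /ballcP; rewrite ltrBrDr; apply: le_lt_trans.
  by rewrite -{1}(subrK z0 z) -[normc (z0 - z)]normcN opprB; exact: normcD.
split=> [|z /zs|z /zs zs'].
- by apply: open_nbhs_ballc; rewrite subr_gt0.
- move=> zs'; exact: (@derivable_fsum _ _ p1 _ _ _ _ r'0 s0 sr mx xA z zs').
have bz : gbounded s (fun n => z ^+ n) by apply: gbounded_expr; exact: ltW.
have bt t : gbounded (r^-1 * s) (fun n => z ^+ n * x_ n t).
  exact: (gbounded_fsum xA t bz).
apply: local_resolvent_eq => //; first exact: (bounded_fsum r'0 s0 sr mx xA bz).
move=> t; rewrite (wrot_fsum sr01)//.
rewrite (_ : (fun n => _) = (fun n => z ^+ n * backward n t)); last first.
  by apply/funext => n; rewrite wrot_backward.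
have bt' : gbounded (r^-1 * s) (fun n => z ^+ n * backward n t).
  exact: (gbounded_fsum bA t bz).
(* S lowers the index of each backward iterate by one: the term n = 0 becomes [x], and the others
   form z times the original series. *)
rewrite (csumS sr01)// expr0 mul1r /fsum -(csumZ _ sr01)//; congr (_ + _).
  by rewrite /backward /= mulr0n subr0 /cocycle big_ord0 invr1 mul1r x_frac.
by congr csum; apply/funext => n; rewrite exprS mulrA.
Qed.

(** Starting from - x absorbs the sign of the outer series. *)
Definition forward n : R -> R[i] := iter n (wrot a b) (fun t => - x t).

Lemma cmeasurable_forward n : cmeas (forward n).
Proof.
elim: n => [|n IH]; last exact: cmeasurable_wrot.
case: bx => mx _; rewrite /= (_ : (fun t => - x t) = (fun t => -1 * x t)).
  by apply: cmeasurableM => //; split; exact: measurable_cst.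
by apply/funext => t; rewrite mulN1r.
Qed.

Lemma forward_bound r : e1 < r -> exists A, forall n t, normc (forward n t) <= A * r ^+ n.
Proof.
move=> er; have [C C0 Cr] := cocycle_le_geometric er.
have [_ [M xM]] := bx; have M0 : 0 <= M by apply: le_trans (xM 0); exact: normc_ge0.
have cM n t : normc (forward n t) <= cocycle a b n t * M.
  elim: n t => [|n IH] t; first by rewrite /= normcN /cocycle big_ord0 mul1r.
  rewrite /forward iterS /wrot normcM normc_frac cocycleS -(cocycle_frac a b n (t + b)).
  by rewrite -mulrA ler_wpM2l ?frac_ge0//; exact: IH.
exists (C * M) => n t; apply: le_trans (cM n t) _.
by rewrite mulrAC ler_wpM2r.
Qed.

Lemma derivable_comp_inv (X : normedModType R[i]) (P : R[i] -> X) (z : R[i]) :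
  z != 0 -> derivable P z^-1 1 -> derivable (fun w : R[i] => P w^-1) z 1.
Proof.
move=> z0 dP; apply/derivable1_diffP.
apply: (@differentiable_comp _ _ _ _ (fun w : R[i] => w^-1) P).
  by apply/derivable1_diffP; apply: derivableV => //; exact: derivable_id.
exact/derivable1_diffP.
Qed.

Lemma local_resolvent_outside (z0 : R[i]) : e1 < normc z0 ->
  local_resolvent T (toLp x) z0.
Proof.
(* Here e^-1 < r < s < |z0|: the forward iterates are O(r^n), and |z| > s makes the series in z^-1
   converge geometrically. *)
move=> z0e; pose r := (e1 + normc z0) / 2; pose s := (r + normc z0) / 2.
have e0 : 0 < e1 by exact: expR_gt0.
have er : e1 < r by rewrite /r; lra.
have rz : r < normc z0 by rewrite /r; lra.
have rs : r < s by rewrite /s; lra.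
have sz : s < normc z0 by rewrite /s; lra.
have r0 : 0 < r by lra.
have s0 : 0 < s by lra.
have rs1 : r * s^-1 < 1 by rewrite ltr_pdivrMr// mul1r.
have s'0 : 0 <= s^-1 by rewrite invr_ge0 ltW.
have rs01 : 0 <= r * s^-1 < 1 by rewrite mulr_ge0// ltW.
have [A fA] := forward_bound er.
have A0 : 0 <= A by have := fA 0%N 0; rewrite expr0 mulr1; apply: le_trans; exact: normc_ge0.
(* $\sum_n z^{-n-1} S^n (- x)$ as a power series in $z^{-1}$ without constant term. *)
pose y_ n := if n is m.+1 then forward m else (fun=> 0 : R[i]).
have yA n t : normc (y_ n t) <= A / r * r ^+ n.
  case: n => [|n]; rewrite /y_.
    rewrite normc0; apply: mulr_ge0; first exact: divr_ge0 A0 (ltW r0).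
    exact: exprn_ge0 (ltW r0).
  by rewrite exprS mulrA divfK ?gt_eqF.
have my n : cmeas (y_ n).
  by case: n => [|n]; [exact: cmeasurable0|exact: cmeasurable_forward].
exists (ball z0 (normc z0 - s)%:C), (fun z : R[i] => toLp (fsum y_ (fun n => z^-1 ^+ n))).
have zs z : ball z0 (normc z0 - s)%:C z -> s < normc z.
  move=> /ballcP; have := normcD (z0 - z) z; rewrite subrK; lra.
split=> [|z /zs sz'|z /zs sz'].
- by apply: open_nbhs_ballc; rewrite subr_gt0.
- have z0' : z != 0 by apply: contraTneq sz' => ->; rewrite normc0 -leNgt ltW.
  apply: (@derivable_comp_inv _ (fun w : R[i] => toLp (fsum y_ (fun n => w ^+ n)))) => //.
  apply: (@derivable_fsum _ _ p1 _ _ _ _ (ltW r0) s'0 rs1 my yA).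
  by rewrite normcV ltf_pV2 ?posrE// (lt_trans s0).
have z0' : z != 0 by apply: contraTneq sz' => ->; rewrite normc0 -leNgt ltW.
set w := z^-1.
have bw : gbounded s^-1 (fun n => w ^+ n).
  by apply: gbounded_expr; rewrite normcV lef_pV2 ?posrE ?ltW// (lt_trans s0).
have byt t : gbounded (r * s^-1) (fun n => w ^+ n * y_ n t).
  exact: (gbounded_fsum yA t bw).
apply: local_resolvent_eq => //; first exact: (bounded_fsum (ltW r0) s'0 rs1 my yA bw).
move=> t; rewrite (wrot_fsum rs01)//.
have wy n : wrot a b (y_ n.+1) = y_ n.+2 by [].
have wy0 : wrot a b (y_ 0%N) t = 0 by rewrite /wrot mulr0.
have bf : gbounded (r * s^-1) (fun n => w ^+ n * forward n t).
  exact: (gbounded_fsum fA t bw).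
have bf1 : gbounded (r * s^-1) (fun n => w ^+ n.+1 * forward n.+1 t) by exact: (gboundedS bf).
have E1 : csum (fun n => w ^+ n * wrot a b (y_ n) t) =
    csum (fun n => w ^+ n.+1 * forward n.+1 t).
  rewrite (csumS rs01) ?wy0 ?mulr0 ?add0r//.
  have -> : (fun n => w ^+ n * wrot a b (y_ n) t) =
      (fun n => if n is m.+1 then w ^+ m.+1 * forward m.+1 t else 0).
    by apply/funext => -[|n]; rewrite ?wy0 ?mulr0.
  case: bf1 => B Bf; exists (B / (r * s^-1)) => -[|n].
    have B0 := le_trans (normc_ge0 _) (Bf 0%N); rewrite expr0 mulr1 in B0.
    by rewrite normc0 expr0 mulr1; apply: divr_ge0 B0 _; case/andP: rs01.
  by rewrite [(r / s) ^+ _]exprS mulrA divfK ?Bf// mulf_neq0 ?invr_neq0 ?gt_eqF.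
rewrite E1 /fsum (csumS rs01 (byt t)) mulr0 add0r.
have -> : (fun n => w ^+ n.+1 * y_ n.+1 t) = (fun n => w * (w ^+ n * forward n t)).
  by apply/funext => n; rewrite exprS mulrA.
(* The factor z removes one power of w = z^-1, so that z F is S F plus the term n = 0, which is -
   x. *)
rewrite (csumZ _ rs01)// mulrA mulfV// mul1r (csumS rs01 bf).
by rewrite expr0 mul1r addrA addrN add0r.
Qed.

Lemma toLp_local_spectrum :
  local_spectral_subspace T [set z : R[i] | `|z| = e1%:C] (toLp x).
Proof.
move=> z /= nz; rewrite normrc; congr _%:C.
have [ze|ze|//] := ltgtP (normc z) e1; exfalso; apply: nz.
- exact: local_resolvent_inside.
- exact: local_resolvent_outside.
Qed.

End local_resolvents.

(** * Density and property (C) *)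

Section density.
Context {R : realType}.
Variables (p : R) (p1 : 1 <= p).
Local Notation mu := (@leb01 R).
Local Notation pi := (\pi_(cLspace mu p1)).
Local Notation toLp := (toLp p1).

Let p0 : 0 < p. Proof. exact: lt_le_trans p1. Qed.

Lemma leb01_le1 (A : set R) : measurable A -> (mu A <= 1)%E.
Proof. by move=> mA; rewrite -leb01_setT; apply: le_measure; rewrite ?inE. Qed.

Lemma cLfun_integrable (f : cLfunType mu p1) :
  mu.-integrable setT (EFin \o (fun t => normc (f t) `^ p)).
Proof.
have /set_mem[mf] := cLfunP f; rewrite cLnormE => lf.
apply/integrableP; split; first exact: measurable_normc_powR.
rewrite (eq_integral (fun t => (normc (f t) `^ p)%:E)); last first.
  by move=> t _; rewrite /= ger0_norm// powR_ge0.
by apply: lty_poweRy lf; rewrite gt_eqF// invr_gt0.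
Qed.

Lemma superlevel_measure (g : R -> R) (d : R) : measurable_fun [set: R] g -> 0 < d ->
  exists n, (mu [set t | (n%:R < g t)%R] < d%:E)%E.
Proof.
move=> mg d0; pose F n := [set t | n%:R < g t].
have mF n : measurable (F n) by exact: measurable_superlevel.
have F0 : \bigcap_n F n = set0.
  apply/seteqP; split => // t Ft; have := Ft (Num.bound (g t)) I.
  rewrite /F/= => gt; have [g0|g0] := leP 0 (g t).
    by have := archi_boundP g0; rewrite ltNge (ltW gt).
  by have := lt_trans gt g0; rewrite ltrn0.
have Fcvg : (mu \o F) n @[n --> \oo] --> mu (\bigcap_n F n).
  apply: nonincreasing_cvg_mu => //.
  - by apply: le_lt_trans (leb01_le1 (mF 0%N)) _; rewrite ltry.
  - by rewrite F0.
  - apply/nonincreasing_seqP => n; apply/subsetPset => t; rewrite /F/=.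
    by apply: le_lt_trans; rewrite ler_nat.
apply: contrapT => /forallNP dF.
have : (d%:E <= lim ((mu \o F) n @[n --> \oo]))%E.
  apply: lime_ge; first by apply/cvg_ex; eexists; exact: Fcvg.
  by apply: nearW => n; rewrite leNgt; exact/negP/dF.
by rewrite (cvg_lim _ Fcvg)// F0 measure0 lee_fin leNgt d0.
Qed.

Lemma tempered_frac (a b l t : R) : tempered a b l (frac t) -> tempered a b l t.
Proof.
have E j : frac (frac t + a + b *+ j) = frac (t + a + b *+ j).
  by rewrite -[frac t + _ + _]addrA fracDl addrA.
move=> tt n; have [t1 t2] := tt n; split; first by rewrite -E.
by under eq_bigr do rewrite -E.
Qed.

(** [x] is [f] set to 0 on a small set that contains the points with a bad orbit and those where |f|
    is large. Absolute continuity of the integral of |f|^p makes the change small in L^p. *)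
Lemma tempered_approximation (a b : R) (F : Lp01 p1) (e : R) : 0 < e ->
  exists l x, [/\ 0 < l, bounded_cmeas x, forall t, x (frac t) = x t,
    forall t, x t != 0 -> tempered a b l t & `|F - toLp x| <= e%:C].
Proof.
move=> e0; elim/quotW: F => f.
have /set_mem[mf _] := cLfunP f.
have ep0 : 0 < e `^ p by rewrite powR_gt0.
have [d [d0 fd]] := integral_normr_continuous (cLfun_integrable f) ep0.
have d20 : 0 < d / 2 by rewrite divr_gt0.
have [n nd] := superlevel_measure (measurable_normc mf) d20.
(* The bad orbits then have measure at most d / 4 and the large values less than d / 2, below d in
   total. *)
have l0 : 0 < (d / 4)^-1 by rewrite invr_gt0 divr_gt0.
have [B [mB Bl] Bt] := tempered_measure a b l0.
set L := [set t | _] in nd.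
have mL : measurable L by exact: measurable_superlevel (measurable_normc mf).
pose A := B `|` L; have mA : measurable A by exact: measurableU.
have muA : (mu A < d%:E)%E.
  apply: le_lt_trans (@measureU2 _ _ _ mu B L mB mL) _.
  rewrite (_ : d = d / 2 + d / 2); last by rewrite -splitr.
  rewrite EFinD lteD//; apply: le_lt_trans Bl _; rewrite lte_fin invrK.
  by rewrite ltr_pM2l// ltf_pV2 ?posrE// ltr_nat.
pose G (v : R) : R[i] := (\1_(~` A) v)%:C * f v.
(* Composing with [frac] makes the function 1-periodic and changes nothing on [0,1). *)
pose x t := G (frac t).
have mG : cmeasurable (G : measurableTypeR R -> R[i]).
  apply: cmeasurableM => //; apply: cmeasurable_real.
  by apply: measurable_indic; exact: measurableC.
have bx : bounded_cmeas x.
  split.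
    have := cmeasurable_rot 0 mG; rewrite (_ : (fun t => _) = x)//.
    by apply/funext => t; rewrite addr0.
  exists n%:R => t; rewrite /x /G indicE.
  have [|] := boolP (frac t \in ~` A).
    rewrite inE => /not_orP[_]; rewrite /L/= => /negP; rewrite -leNgt => fn.
    by rewrite mul1r.
  by rewrite mul0r normc0.
exists (d / 4)^-1, x; split => //.
- by move=> t; rewrite /x frac_id// frac_ge0 frac_lt1.
- move=> t xt; apply: tempered_frac; apply: Bt => Bt'; move: xt.
  by rewrite /x /G indicE memNset ?mul0r ?eqxx//; apply; left.
pose gx : cLfunType mu p1 := insubd (0 : cLfunType mu p1) x.
have gxE : gx = x :> (R -> R[i]) by exact: bounded_insubdK.
rewrite -[toLp x]/(pi gx) -raddfB -[`|_|]/(cLspace_norm _) cLspace_norm_pi lecR.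
rewrite -lee_fin fineK ?cLnorm_fin// cLnormE.
have /set_mem[mfx _] := cLfunP (f - gx).
have -> : e = (e `^ p) `^ p^-1 by rewrite -powRrM mulfV ?gt_eqF// powRr1// ltW.
rewrite -poweR_EFin; apply: gt0_ler_poweR.
- by rewrite invr_ge0 ltW.
- by rewrite in_itv/= leey integral_ge0// => t _; rewrite lee_fin powR_ge0.
- by rewrite in_itv/= leey lee_fin powR_ge0.
have {}fd := fd A mA muA.
set g := (fun t => normc (f t) `^ p) in fd.
have mg : measurable_fun setT (EFin \o g) by exact: measurable_normc_powR.
have g0 t : (0 <= (EFin \o g) t)%E by rewrite lee_fin powR_ge0.
apply: (@le_trans _ _ (\int[mu]_(t in A) (EFin \o g) t)%E); last first.
  have iA : mu.-integrable A (EFin \o g).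
    by apply: (@integrableS _ _ _ mu setT A) => //; exact: cLfun_integrable.
  rewrite /Rintegral (eq_integral (EFin \o g)) -?lte_fin in fd; last first.
    by move=> t _; rewrite /= ger0_norm// powR_ge0.
  by rewrite fineK in fd; [exact: ltW|exact: integrable_fin_num].
rewrite [leRHS]integral_mkcond; apply: ae_ge0_le_integral => //.
- by move=> t _; rewrite lee_fin powR_ge0.
- exact: measurable_normc_powR.
- by move=> t _; apply: erestrict_ge0 => ? _; exact: g0.
- by apply/(measurable_restrictT _ mA); exact: measurable_funTS.
- apply: leb01_ae => t t01 _; rewrite cLfunBE gxE /x (frac_id t01) /G indicE patchE.
  have [tA|tA] := boolP (t \in A).
    by rewrite memNset ?mul0r ?subr0// => /(_ (set_mem tA)).
  rewrite mem_set; last by move=> /mem_set; rewrite (negbTE tA).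
  by rewrite mul1r subrr normc0 powR0// gt_eqF.
Qed.
End density.

(** * Density of the spectral subspace and failure of property (C) *)

Section weighted_rotations.
Context {R : realType}.
Variables (p : R) (p_gt1 : 1 < p).
Let p1 : 1 <= p := ltW p_gt1.
Local Notation mu := (@leb01 R).
Local Notation pi := (\pi_(cLspace mu p1)).

Let p0 : 0 < p. Proof. exact: lt_le_trans p1. Qed.

(** Where the weight is at most 1/x, a set of measure 1/x, |g| is at least x. So the integral [K] of
    |g|^p is at least x^(p-1), which is unbounded in x because p > 1. *)
Lemma inverse_weight_notin_Lp (c : R) (g : cLfunType mu p1) :
  ~ (\forall t \ae mu, (frac (t + c))%:C * g t = 1).
Proof.
move=> cg; have iG := cLfun_integrable g.
have /set_mem[mg _] := cLfunP g.
set G := EFin \o _ in iG.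
have G0 t : (0 <= G t)%E by rewrite lee_fin powR_ge0.
have mG : measurable_fun setT G by exact: measurable_normc_powR.
have IG : (\int[mu]_t G t)%E \is a fin_num by exact: integrable_fin_num.
pose K := fine (\int[mu]_t G t)%E.
have K0 : 0 <= K by apply: fine_ge0; exact: integral_ge0.
(* This gives x^(p-1) = K + 2 > K; the 2 also ensures x > 1, so that [0, 1/x] lies in [0,1). *)
pose x := (K + 2) `^ (p - 1)^-1.
have pB0 : 0 < p - 1 by rewrite subr_gt0.
have x1 : 1 < x.
  rewrite (_ : 1 = 1 `^ (p - 1)^-1); last by rewrite powR1.
  rewrite gt0_ltr_powR ?invr_gt0 ?nnegrE//; lra.
have x0 : 0 < x by exact: lt_trans x1.
have xp : x `^ p = x * (K + 2).
  have -> : x `^ p = x * x `^ (p - 1) by rewrite mulr_powRB1// ltW.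
  by rewrite -powRrM mulVf ?gt_eqF// powRr1// addr_ge0.
pose A := (fun t => frac (t + c)) @^-1` `[0, x^-1]%classic.
have mA : measurable A.
  by rewrite -[A]setTI; apply: measurable_fracD => //; exact: measurable_itv.
have muA : mu A = (x^-1)%:E.
  rewrite leb01_rot; last exact: measurable_itv.
  rewrite -[LHS]/(lebesgue_measure _).
  rewrite (_ : _ `&` _ = `[0, x^-1]%classic); last first.
    apply/setIidl => t /=; rewrite !in_itv/= => /andP[-> tx].
    by apply: le_lt_trans tx _; rewrite invf_lt1.
  by rewrite lebesgue_measure_itv/= lte_fin invr_gt0 x0 oppr0 adde0.
have : (\int[mu]_(t in A) (cst (x `^ p)%:E t) <= \int[mu]_t G t)%E.
  apply: (@le_trans _ _ (\int[mu]_(t in A) G t)%E); last first.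
    by apply: ge0_subset_integral.
  apply: ae_ge0_le_integral => //.
  - by move=> t _; rewrite lee_fin powR_ge0.
  - exact: measurable_funTS.
  - apply: (@filterS _ _ (ae_filter_ringOfSetsType mu)) cg => t {}cg.
    rewrite /A/= in_itv/= => /andP[_ tx].
    rewrite lee_fin ge0_ler_powR ?nnegrE ?normc_ge0 ?(ltW p0) ?(ltW x0)//.
    have := congr1 (@normc R) cg; rewrite normc1 normcM normc_frac => n1.
    have f0 : 0 < frac (t + c).
      rewrite lt_neqAle frac_ge0 andbT eq_sym; apply/eqP => f0.
      by move: n1; rewrite f0 mul0r => /eqP; rewrite eq_sym oner_eq0.
    have -> : normc (g t) = (frac (t + c))^-1.
      by apply: (mulfI (lt0r_neq0 f0)); rewrite n1 mulfV ?gt_eqF.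
    by rewrite -[leLHS]invrK lef_pV2 ?posrE ?invr_gt0.
rewrite integral_cst// muA -EFinM xp mulrAC mulfV ?gt_eqF// mul1r.
by rewrite -(fineK IG) lee_fin -/K; lra.
Qed.

Section operator.
Variables (a b c : R) (T : {linear Lp01 p1 -> Lp01 p1}).
Hypothesis b_irr : irrational b.
Hypothesis T_toLp : forall f, bounded_cmeas f -> T (toLp p1 f) = toLp p1 (wrot a b f).
Hypothesis T_range : forall g : cLfunType mu p1, T (pi g) = toLp p1 (fun=> 1) ->
  \forall t \ae mu, (frac (t + c))%:C * g t = 1.

Let circle := [set z : R[i] | `|z| = (expR (-1))%:C].

Lemma wrot_spectral_subspace_dense : dense (local_spectral_subspace T circle).
Proof.
move=> O [F OF] oO.
have /nbhs_ballP[e /= e0 FO] : nbhs F O by exact: open_nbhs_nbhs.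
have eE : e = (complex.Re e)%:C by rewrite RRe_real// realE ltW.
have e'0 : 0 < complex.Re e by rewrite -ltcR -eE.
have [|l [x [l0 bx xf xt Fx]]] := tempered_approximation a b F (_ : 0 < complex.Re e / 2).
  by rewrite divr_gt0.
exists (toLp p1 x); split; last exact: (toLp_local_spectrum b_irr T_toLp l0 bx xf xt).
apply: FO; rewrite -ball_normE /=; apply: le_lt_trans Fx _.
by rewrite eE ltcR ltr_pdivrMr// ltr_pMr// ltr1n.
Qed.

Lemma wrot_not_Dunford : ~ Dunford_property_C T.
Proof.
move=> TC.
have ccircle : closed circle.
  apply: (@preimage_closed R[i] R[i] Num.norm [set (expR (-1))%:C]) => [z _|].
    exact: norm_continuous.
  exact/accessible_closed_set1/hausdorff_accessible/norm_hausdorff.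
(* Under (C) the dense subspace is closed, hence everything. Then 0, off the circle, is in the local
   resolvent of 1, and the value there of the local resolvent function is a preimage of 1. *)
have one : local_spectral_subspace T circle (toLp p1 (fun=> 1)).
  apply: contrapT => n1.
  have nS : ~` local_spectral_subspace T circle !=set0 by exists (toLp p1 (fun=> 1)).
  by have [G []] := wrot_spectral_subspace_dense nS (closed_openC (TC _ ccircle)).
have : local_resolvent T (toLp p1 (fun=> 1)) 0.
  apply: contrapT => /one zc; have {zc} : `|0 : R[i]| = (expR (-1))%:C := zc.
  by rewrite normr0 => -[/esym/eqP]; rewrite gt_eqF// expR_gt0.
case=> U [f [[_ U0] _ /(_ 0 U0)]]; rewrite scale0r subr0.
elim/quotW: (f 0) => g /T_range; exact: inverse_weight_notin_Lp.
Qed.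

End operator.
End weighted_rotations.

Theorem theorem5p4 (R : realType) (alpha p : R)
    (alpha01 : 0 < alpha < 1) (alpha_irr : irrational alpha) (p_gt1 : 1 < p) :
  let T := bishop (ltW p_gt1) alpha in
  let T' := bishop_adj (ltW p_gt1) alpha in
  let circle := [set z : R[i] | `|z| = (expR (-1))%:C] in
  [/\ dense (local_spectral_subspace T circle),
      dense (local_spectral_subspace T' circle),
      ~ Dunford_property_C T
    & ~ Dunford_property_C T'].
Proof.
move=> T T' circle.
have alphaN_irr : irrational (- alpha).
  move=> [q _ qa]; apply: alpha_irr; exists (- q) => //.
  by rewrite rmorphN/= qa opprK.
have b1 : bounded_cmeas (fun=> 1 : R[i]).
  split; first by split; exact: measurable_cst.
  by exists 1 => t; rewrite normc1.
have TR (g : cLfunType (@leb01 R) (ltW p_gt1)) :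
    T (\pi_(cLspace (@leb01 R) (ltW p_gt1)) g) = toLp (ltW p_gt1) (fun=> 1) ->
    \forall t \ae @leb01 R, (frac (t + - alpha))%:C * g t = 1.
  (* Rotating t g({t + alpha}) = 1 by - alpha puts g at t, with weight {t - alpha}. *)
  rewrite /T bishop_pi => /cLspace_eqP /(ae_rot (- alpha)).
  have t01 : \forall t \ae @leb01 R, 0 <= t < 1 by exact: leb01_ae.
  apply: (@filterS2 _ _ (ae_filter_ringOfSetsType leb01) _ _ _ _ t01).
  move=> t {}t01; rewrite /= /bishop_fun bounded_insubdK// fracDl subrK.
  by rewrite (frac_id t01).
have T'R (g : cLfunType (@leb01 R) (ltW p_gt1)) :
    T' (\pi_(cLspace (@leb01 R) (ltW p_gt1)) g) = toLp (ltW p_gt1) (fun=> 1) ->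
    \forall t \ae @leb01 R, (frac (t + 0))%:C * g t = 1.
  rewrite /T' bishop_adj_pi => /cLspace_eqP /(ae_rot alpha).
  have t01 : \forall t \ae @leb01 R, 0 <= t < 1 by exact: leb01_ae.
  apply: (@filterS2 _ _ (ae_filter_ringOfSetsType leb01) _ _ _ _ t01).
  move=> t {}t01; rewrite /= /bishop_adj_fun bounded_insubdK// fracDl addrK.
  by rewrite addr0 (frac_id t01).
split.
- exact: (wrot_spectral_subspace_dense alpha_irr (bishop_toLp _ alpha)).
- exact: (wrot_spectral_subspace_dense alphaN_irr (bishop_adj_toLp _ alpha)).
- exact: (wrot_not_Dunford alpha_irr (bishop_toLp _ alpha) TR).
- exact: (wrot_not_Dunford alphaN_irr (bishop_adj_toLp _ alpha) T'R).
Qed.
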